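(* Let $K,K'$ be two equivalent oriented flat-virtual link diagrams, in each of which every link component passes through at least one classical underpass. Then $\Delta(K)\doteq\Delta(K')$, i.e. $\Delta(K')=\pm t^{a}v^{b}u^{c}\Delta(K)$ for some integers $a,b,c$.
   Context: A flat-virtual link diagram is a four-valent graph in the plane each of whose vertices is classical (one pair of opposite edges is marked as the overcrossing strand), flat, or virtual. Two (oriented) diagrams are equivalent if they are related by planar isotopy and a finite sequence of the following moves and their inverses (respecting orientations): (1) the classical Reidemeister moves 1, 2, 3, involving classical crossings only; (2) the flat second and third Reidemeister moves, involving flat crossings only and obtained from the classical ones by forgetting over/under information; (3) the mixed flat-classical third Reidemeister move: a strand containing two consecutive flat crossings passes through a classical crossing, whose over/under structure is preserved; (4) the detour move: a strand containing only virtual crossings and virtual self-crossings is removed and replaced by another strand with the same endpoints, all of whose new intersections are marked as virtual crossings. Let $K$ be an oriented flat-virtual link diagram with $n$ classical crossings such that each component passes through at least one classical underpass. A long arc is a segment of $K$ going from one classical underpass to the next one (it may contain overpasses, virtual crossings and flat crossings). There are exactly $n$ long arcs; number the classical crossings $1,\dots,n$ and number the long arcs so that the $i$-th long arc starts at (emanates from the underpass of) the $i$-th crossing. Each long arc is subdivided by virtual and flat crossings into short arcs. Each short arc $s$ gets a label $l(s)$, a monomial $u^kv^m$ ($k,m\in\mathbb{Z}$): the initial short arc of each long arc gets label $1$; moving along the long arc, when passing through a virtual crossing the label is multiplied by $v^{\pm1}$, and when passing through a flat crossing it is multiplied by $u^{\pm1}$. The exponent is $+1$ if the transversal strand crosses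 the strand being followed from left to right, and $-1$ if it crosses it from right to left. The matrix $A(K)$ is the $n\times n$ matrix whose $i$-th row is as follows. At the $i$-th classical crossing, let $w(i)=\pm1$ be the writhe (sign), let the incoming under short arc belong to the long arc number $i'$ and have label $l'$, and let the short arc forming the overcrossing belong to the long arc number $i''$ and have label $l''$. Then $a_{i,i}=-1$, $a_{i,i'}=l't^{w(i)}$, $a_{i,i''}=l''(1-t^{w(i)})$, all other entries of the row being $0$; if some of the indices $i,i',i''$ coincide, the corresponding coefficients are added. Set $\Delta(K)=\det A(K)\in\mathbb{Z}[t^{\pm1},v^{\pm1},u^{\pm1}]$. *)

(* Defs.v *)
(* Mathematical Components, with multinomials for Z[t, v, u]. *)
From mathcomp Require Import all_boot all_order all_algebra perm.
From mathcomp Require Import mpoly fraction.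
From Stdlib Require Import Relations.

Set Implicit Arguments.
Unset Strict Implicit.
Unset Printing Implicit Defensive.

Import GRing.Theory.
Local Open Scope ring_scope.

(* Each crossing x has two branches (x, false) and (x, true), named so that the
   directions of (x, false) and (x, true), in this order, form a positively
   oriented frame of the plane: with (x, false) heading east, (x, true) heads
   north.  So following (x, true) one sees the other branch pass from left to
   right, and following (x, false) one sees it pass from right to left.
   [Classical o] says that (x, o) is the overcrossing branch. *)
Inductive crossing_kind := Classical of bool | Flat | Virtual.

Definition is_classical (k : crossing_kind) : bool :=
  if k is Classical _ then true else false.

(* An oriented four-valent graph with marked vertices, up to isomorphism, given
   by the cyclic words of branches met along its components (a component
   without crossings is the empty word).  Every branch is met exactly once. *)
Record fvcode := FVCode {
  crossing : finType;
  kind : crossing -> crossing_kind;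
  comps : seq (seq (crossing * bool));
  comps_perm : perm_eq (flatten comps) (enum {: crossing * bool}) }.

Section Code.
Variable D : fvcode.
Implicit Types (x i j : crossing D) (p : crossing D * bool).

Definition word_of p : seq (crossing D * bool) :=
  head [::] [seq w <- comps D | p \in w].

Definition nx p : crossing D * bool := next (word_of p) p.
Definition pv p : crossing D * bool := prev (word_of p) p.

(* The edges of the graph are the segments from p to nx p.  The pair (p, true)
   is this edge traversed forwards, (p, false) the edge traversed backwards;
   [face_next] follows an edge, then turns left at the crossing it reaches, so
   that its cycles are the boundaries of the faces, kept on the left.  Around a
   crossing, counterclockwise, one meets: the exit of (x, false), the exit of
   (x, true), the entry of (x, false), the entry of (x, true). *)
Definition face_next (d : crossing D * bool * bool) : crossing D * bool * bool :=
  let: (p, forward) := d in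
  if forward then
    let q := nx p in
    if q.2 then (pv (q.1, false), false) else ((q.1, true), true)
  else
    if p.2 then ((p.1, false), true) else (pv (p.1, true), false).

Definition edge_tail (d : crossing D * bool * bool) : crossing D :=
  if d.2 then d.1.1 else (nx d.1).1.

Definition adjacent : rel (crossing D) := fun x y =>
  [exists b, ((nx (x, b)).1 == y) || ((nx (y, b)).1 == x)].

(* Euler's formula V - E + F = 2 C with E = 2 V: each of the C connected
   components of the graph has genus 0. *)
Definition planar : bool :=
  fcard face_next {: crossing D * bool * bool}
    == (#|crossing D| + 2 * n_comp adjacent {: crossing D})%N.

Definition is_over p : bool :=
  if kind p.1 is Classical o then p.2 == o else false.

Definition is_under p : bool :=
  if kind p.1 is Classical o then p.2 != o else false.

Definition is_flat x : bool := if kind x is Flat then true else false.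

Definition is_virtual x : bool := if kind x is Virtual then true else false.

Definition every_comp_has_underpass : bool := all (has is_under) (comps D).

End Code.

(* A diagram in the plane.  The outer face and the mutual position of the
   connected components of the graph are not recorded. *)
Record fvdiagram := FVDiagram { code :> fvcode; code_planar : planar code }.

Section Moves.

Definition lift_branch (X Y : Type) (f : X -> Y) (p : X * bool) : Y * bool :=
  (f p.1, p.2).

Definition preserves_kind (D D' : fvcode) (f : crossing D -> crossing D') :=
  forall x, kind (f x) = kind x.

(* Words are cyclic and the components are not ordered. *)
Definition isotopic (D D' : fvcode) : Prop :=
  exists (f : crossing D -> crossing D') (k : seq (crossing D * bool) -> nat),
    [/\ bijective f, preserves_kind f &
        perm_eq (comps D') [seq rot (k w) (map (lift_branch f) w) | w <- comps D]].

(* D is obtained from D' by forgetting the crossings in Y, f being the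
   inclusion of the remaining ones. *)
Definition forgets (D D' : fvcode) (f : crossing D -> crossing D')
    (Y : {set crossing D'}) : Prop :=
  [/\ injective f, (forall y, (y \in codom f) = (y \notin Y)), preserves_kind f &
      [seq map (lift_branch f) w | w <- comps D]
      = [seq [seq p <- w | p.1 \notin Y] | w <- comps D']].

(* D' has a monogon with a classical corner x, which is removed in D. *)
Definition reidemeister1 (D D' : fvcode) : Prop :=
  exists (f : crossing D -> crossing D') (x : crossing D') (b : bool),
    [/\ is_classical (kind x), nx (x, b) = (x, ~~ b) & forgets f [set x]].

(* D' has a bigon with corners x and y, which is removed in D: one side goes
   from (x, b) to (y, ~~ b), the other one joins the two other branches, in
   either direction.  The opposite values b and ~~ b say that the second strand
   leaves the first one on the side from which it comes back, so that the two
   sides do bound a face.  In the classical case one strand is above the other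
   one at both corners. *)
Definition reidemeister2 (D D' : fvcode) : Prop :=
  exists (f : crossing D -> crossing D') (x y : crossing D') (b : bool),
    [/\ x != y,
        (exists o, kind x = Classical o /\ kind y = Classical (~~ o)) \/
          (is_flat x /\ is_flat y),
        nx (x, b) = (y, ~~ b),
        nx (x, ~~ b) = (y, b) \/ nx (y, b) = (x, ~~ b) &
        forgets f [set x; y]].

(* The edges d1, d2, d3 bound a triangular face of D with distinct corners, and
   pushing the strand of d1 across the opposite corner (the tail of d3) yields
   D': along each of the three strands the two corners are exchanged.  The
   corners on the strand of d1 are either both flat (and then the opposite
   corner is flat or classical), or both classical overpasses of this strand
   (and then the opposite corner is classical). *)
Definition reidemeister3 (D D' : fvcode) : Prop :=
  exists (f : crossing D -> crossing D') (d1 d2 d3 : crossing D * bool * bool),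
    let p1 := d1.1 in let p2 := d2.1 in let p3 := d3.1 in
    let exchange q := tperm p1 (nx p1) (tperm p2 (nx p2) (tperm p3 (nx p3) q)) in
    [/\ [/\ face_next d1 = d2, face_next d2 = d3 & face_next d3 = d1],
        uniq [:: edge_tail d1; edge_tail d2; edge_tail d3],
        [\/ [/\ is_over p1, is_over (nx p1) & is_classical (kind (edge_tail d3))],
            [/\ is_flat p1.1, is_flat (nx p1).1 & is_flat (edge_tail d3)] |
            [/\ is_flat p1.1, is_flat (nx p1).1
              & is_classical (kind (edge_tail d3))]],
        (bijective f /\ preserves_kind f) &
        comps D' = [seq [seq lift_branch f (exchange q) | q <- w] | w <- comps D]].

(* The strands s1 and s2 meet virtual crossings only (self-crossings of the
   strand are met twice).  Removing the strand s1 from D1 and s2 from D2, with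
   all the crossings on them, leaves the same graph E; in E the removed strand
   runs, without crossings, from the end of the first word to its beginning. *)
Definition detour (D1 D2 : fvcode) : Prop :=
  exists (E : fvcode) (f1 : crossing E -> crossing D1)
         (f2 : crossing E -> crossing D2) s1 w1 r1 s2 w2 r2,
    [/\ comps D1 = (s1 ++ w1) :: r1 /\ comps D2 = (s2 ++ w2) :: r2,
        all (fun p => is_virtual p.1) s1, all (fun p => is_virtual p.1) s2,
        forgets f1 [set x | x \in map fst s1] &
        forgets f2 [set x | x \in map fst s2]].

End Moves.

Definition fv_move (K K' : fvdiagram) : Prop :=
  isotopic K K' \/ reidemeister1 K K' \/ reidemeister2 K K'
  \/ reidemeister3 K K' \/ detour K K'.

Definition fv_equivalent : fvdiagram -> fvdiagram -> Prop :=
  clos_refl_sym_trans fvdiagram fv_move.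

(* The Laurent polynomial ring Z[t^+-1, v^+-1, u^+-1] is seen inside the field of
   fractions of Z[t, v, u]. *)
Definition Rtvu := {fraction {mpoly int[3]}}.
Definition t_var : Rtvu := FracField.tofrac ('X_(@Ordinal 3 0 isT) : {mpoly int[3]}).
Definition v_var : Rtvu := FracField.tofrac ('X_(@Ordinal 3 1 isT) : {mpoly int[3]}).
Definition u_var : Rtvu := FracField.tofrac ('X_(@Ordinal 3 2 isT) : {mpoly int[3]}).

Section Delta.
Variable D : fvcode.
Implicit Types (i j : crossing D) (p : crossing D * bool).

(* Only used for classical crossings. *)
Definition over_branch i : crossing D * bool :=
  (i, if kind i is Classical o then o else true).
Definition under_branch i : crossing D * bool :=
  (i, if kind i is Classical o then ~~ o else false).

(* The sign is +1 when (over, under) is a positively oriented frame. *)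
Definition writhe i : int :=
  if kind i is Classical true then -1 else 1.

(* The branches met by the long arc emanating from the underpass of i, up to
   and including the next underpass. *)
Definition long_arc i : seq (crossing D * bool) :=
  let ps := traject (@nx D) (nx (under_branch i)) #|{: crossing D * bool}| in
  take (find (@is_under D) ps).+1 ps.

Definition label_factor p : Rtvu :=
  match kind p.1 with
  | Classical _ => 1
  | Flat => u_var ^ (if p.2 then 1 else -1 : int)
  | Virtual => v_var ^ (if p.2 then 1 else -1 : int)
  end.

(* Label of the short arc of the long arc i which arrives at p; since
   overpasses do not change labels, it is also the label of the short arc which
   forms the overcrossing when p is an overpass. *)
Definition label i p : Rtvu :=
  \prod_(q <- take (index p (long_arc i)) (long_arc i)) label_factor q.

Definition numbering (n : nat) (c : 'I_n -> crossing D) : Prop :=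
  injective c /\ forall x, (x \in codom c) = is_classical (kind x).

Definition alexander_matrix (n : nat) (c : 'I_n -> crossing D) : 'M[Rtvu]_n :=
  \matrix_(i, j)
    (  (if j == i then -1 else 0)
     + (if under_branch (c i) \in long_arc (c j)
        then label (c j) (under_branch (c i)) * t_var ^ writhe (c i) else 0)
     + (if over_branch (c i) \in long_arc (c j)
        then label (c j) (over_branch (c i)) * (1 - t_var ^ writhe (c i)) else 0)).

Definition Delta (n : nat) (c : 'I_n -> crossing D) : Rtvu :=
  \det (alexander_matrix c).

End Delta.

(* Main.v *)
(* Replace the long arcs by a square system with one unknown for every
   edge and one equation for every branch through a crossing:
   x_out = factor * x_in at a flat or virtual crossing or at an overpass,
   x_out = t^w x_in + (1 - t^w) x_over at an underpass.  Its determinant makes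
   sense without any assumption on underpasses, and eliminating the unknowns
   which do not start at an underpass turns it into +-Delta.

   Reidemeister moves are local eliminations.  For the detour move, planarity
   provides an Alexander numbering h of the faces (Euler's formula, read as a
   rank count, says that the first cohomology vanishes); rescaling the unknowns
   by v^h moves the factors v^+-1 from the virtual crossings to the other ones,
   so that the gauged determinant no longer sees the virtual crossings. *)
Require Import Defs.
From mathcomp Require Import all_boot all_order all_algebra.
From mathcomp Require Import perm zify ring mpoly fraction.
From Stdlib Require Import Relations.

Set Implicit Arguments.
Unset Strict Implicit.
Unset Printing Implicit Defensive.

Import GRing.Theory.
Local Open Scope ring_scope.

(** * Determinants indexed by a finite type *)

(** A chain of moves between the two diagrams may pass through diagrams with a component that has no
    underpass, where long arcs do not exist. This is why a determinant defined for every diagram is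
    compared along the chain, long arcs reappearing only at its two ends. An edge is named by the
    branch it leaves, so the edge arriving at [p] is [pv p]. Apart from isotopy and the gauge, every
    comparison is one elimination: the removed unknowns must have a triangular block of rows, and
    the product of its diagonal is the only factor that appears. The triangular order is the
    delicate point, because removed edges may follow each other in any manner. Counting the steps
    back to a kept edge provides one when crossings are forgotten, unless a whole component
    disappears; in that case both determinants are 0. Only the first Reidemeister move contributes a
    factor other than 1. *)

Section FinDet.
Variable F : fieldType.
Implicit Types S T : finType.

Definition fdet T (M : T -> T -> F) : F :=
  \det (\matrix_(i < #|T|, j < #|T|) M (enum_val i) (enum_val j)).

(** Two enumerations differ by a permutation which acts on rows and columns alike, so its sign
    occurs twice. *)
Lemma fdet_reindex T (M : T -> T -> F) n (c : 'I_n -> T) : bijective c ->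
  fdet M = \det (\matrix_(i < n, j < n) M (c i) (c j)).
Proof.
move=> c_bij; have eqn : n = #|T| by rewrite -(bij_eq_card c_bij) card_ord.
subst n; case: (c_bij) => c' cK c'K; rewrite /fdet.
have s_inj : injective (fun i : 'I_#|T| => enum_rank (c i)).
  by move=> i j /enum_rank_inj /(bij_inj c_bij).
pose s := perm s_inj.
set A := (X in \det X = _); set B := (X in _ = \det X).
have -> : B = row_perm s (col_perm s A).
  by apply/matrixP=> i j; rewrite !mxE !permE !enum_rankK.
rewrite row_permE col_permE !det_mulmx !det_perm mulrCA mulrA -mulrA.
by rewrite odd_permV -signr_addb addbb mulr1.
Qed.

Lemma fdet_bij S T (f : S -> T) (M : T -> T -> F) : bijective f ->
  fdet (fun p q => M (f p) (f q)) = fdet M.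
Proof.
move=> f_bij; rewrite [RHS](@fdet_reindex _ _ _ (f \o @enum_val S predT)) //.
by apply: bij_comp f_bij (enum_val_bij _).
Qed.

Lemma eq_fdet T (M N : T -> T -> F) : (forall p q, M p q = N p q) ->
  fdet M = fdet N.
Proof. by move=> eqMN; congr (\det _); apply/matrixP=> i j; rewrite !mxE. Qed.

(** A permutation with a nonzero term never increases [r], and decreases it wherever it moves a
    point. The sum of [r] being invariant under permutations, only the identity contributes. *)
Lemma fdet_trig T (M : T -> T -> F) (r : T -> nat) :
    (forall p q, p != q -> M p q != 0 -> (r q < r p)%N) ->
  fdet M = \prod_p M p p.
Proof.
move=> ltr; rewrite /fdet /determinant (bigD1 (1%g : {perm 'I_#|T|})) //= [X in _ + X]big1 => [|s ns1].
  rewrite addr0 odd_perm1 expr0 mul1r (reindex (@enum_val T predT)) /=.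
    by apply: eq_bigr => i _; rewrite mxE perm1.
  exact: onW_bij (enum_val_bij _).
have [/existsP[i /eqP Mi0]|/existsPn Mn0] :=
    boolP [exists i, M (enum_val i) (enum_val (s i)) == 0].
  by rewrite (bigD1 i) //= mxE Mi0 mul0r mulr0.
have ler i : (r (enum_val (s i)) <= r (enum_val i))%N.
  have [->//|nsi] := eqVneq (s i) i.
  by apply/ltnW/ltr => //; rewrite (inj_eq enum_val_inj) eq_sym.
case/eqP: ns1; apply/permP=> i; rewrite perm1; apply/eqP/contraT => nsi.
have : (\sum_j r (enum_val (s j)) < \sum_(j < #|T|) r (enum_val j))%N.
  rewrite (bigD1 i) //= [X in (_ < X)%N](bigD1 i) //= -addSn leq_add //.
    by apply: ltr => //; rewrite (inj_eq enum_val_inj) eq_sym.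
  exact: leq_sum.
by rewrite [X in (_ < X)%N](reindex_inj (@perm_inj _ s)) /= ltnn.
Qed.

(** A Schur complement without inverses. Column [s] of [X] extends the unit vector at [s] to a
    solution of the eliminated rows; [K] is what the kept rows make of these solutions, and [r]
    makes the eliminated block triangular. *)
Lemma fdet_elim S T (M : T -> T -> F) (f : S -> T) (X : T -> S -> F)
    (r : T -> nat) (K : S -> S -> F) :
    injective f ->
    (forall s s', X (f s) s' = (s == s')%:R) ->
    (forall y s, y \notin codom f -> \sum_z M y z * X z s = 0) ->
    (forall p s, \sum_z M (f p) z * X z s = K p s) ->
    (forall y y', y \notin codom f -> y' \notin codom f -> y != y' ->
      M y y' != 0 -> (r y' < r y)%N) ->
  fdet M = \prod_(y | y \notin codom f) M y y * fdet K.
Proof.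
move=> f_inj Xf MX0 MXK ltr.
pose Y : finType := {y : T | y \notin codom f}.
pose g (y : Y) : T := val y.
pose d (z : S + Y) : T := match z with inl s => f s | inr y => g y end.
have d_bij : bijective d.
  apply: inj_card_bij => [[s|y] [s'|y'] /= | ].
  - by move/f_inj->.
  - by move=> eqd; case/negP: (valP y'); rewrite -/(g y') -eqd codom_f.
  - by move=> eqd; case/negP: (valP y); rewrite -/(g y) eqd codom_f.
  - by move/val_inj->.
  rewrite card_sum card_sig -(card_codom f_inj) -(cardC (mem (codom f))).
  by rewrite leq_add2l; apply/subset_leq_card/subsetP=> z; rewrite !inE.
pose e (i : 'I_(#|S| + #|Y|)) : S + Y :=
  match split i with inl i => inl (enum_val i) | inr j => inr (enum_val j) end.
have e_bij : bijective e.
  exists (fun z => match z with inl s => lshift _ (enum_rank s)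
                              | inr y => rshift _ (enum_rank y) end).
    move=> i; rewrite /e; case: split_ordP => j -> /=; by rewrite enum_valK.
  by case=> z; rewrite /e ?(unsplitK (inl _)) ?(unsplitK (inr _)) /= enum_rankK.
rewrite (fdet_reindex _ (bij_comp d_bij e_bij)).
pose Mkk := \matrix_(i < #|S|, j < #|S|) M (f (enum_val i)) (f (enum_val j)).
pose Mky := \matrix_(i < #|S|, j < #|Y|) M (f (enum_val i)) (g (enum_val j)).
pose Myk := \matrix_(i < #|Y|, j < #|S|) M (g (enum_val i)) (f (enum_val j)).
pose Myy := \matrix_(i < #|Y|, j < #|Y|) M (g (enum_val i)) (g (enum_val j)).
pose Xy := \matrix_(i < #|Y|, j < #|S|) X (g (enum_val i)) (enum_val j).
have eS (h : S -> F) : \sum_(i < #|S|) h (enum_val i) = \sum_s h s.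
  by rewrite [RHS](reindex (@enum_val S predT)) //; apply: onW_bij (enum_val_bij _).
have eY (h : T -> F) :
    \sum_(i < #|Y|) h (g (enum_val i)) = \sum_(y : Y) h (g y).
  by rewrite [RHS](reindex (@enum_val Y predT)) //; apply: onW_bij (enum_val_bij _).
have MXE p s : \sum_z M p z * X z s = M p (f s) + \sum_(y : Y) M p (g y) * X (g y) s.
  rewrite (reindex d) /=; last exact: onW_bij.
  rewrite big_sumType /=; congr (_ + _).
  rewrite (bigD1 s) //= Xf eqxx mulr1 big1 ?addr0 // => s' /negPf ns.
  by rewrite Xf ns mulr0.
have -> : (\matrix_(i, j) M ((d \o e) i) ((d \o e) j)) = block_mx Mkk Mky Myk Myy.
  apply/matrixP=> i j; rewrite !mxE /= /e.
  by case: split => i'; rewrite !mxE; case: split => j'; rewrite !mxE.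
(* Column operations: the kept columns become those of [M] times [X], which vanish on the eliminated
   rows. *)
have <- : \det (block_mx Mkk Mky Myk Myy *m block_mx 1%:M 0 Xy 1%:M)
        = \det (block_mx Mkk Mky Myk Myy).
  by rewrite det_mulmx det_lblock !det1 !mulr1.
rewrite mulmx_block !mulmx0 !mulmx1 !add0r.
have -> : Myk + Myy *m Xy = 0.
  apply/matrixP=> i j; rewrite !mxE.
  under eq_bigr do rewrite !mxE.
  by rewrite (eY (fun z => M _ z * X z _)) -MXE MX0 // (valP (enum_val i)).
rewrite det_ublock mulrC; congr (_ * _).
  transitivity (\prod_(y : Y) M (g y) (g y)).
    rewrite -(@fdet_trig _ (fun y y' => M (g y) (g y')) (r \o g)) // => y y' ny.
    by apply: ltr; rewrite ?(valP y) ?(valP y').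
  rewrite [RHS](reindex_omap (val : Y -> T) insub) /= => [|y Yy]; last by rewrite insubT.
  by apply: eq_bigl => y; rewrite valK eqxx (valP y).
congr (\det _); apply/matrixP=> i j; rewrite !mxE.
under eq_bigr do rewrite !mxE.
by rewrite (eY (fun z => M _ z * X z _)) -MXE MXK.
Qed.

Lemma fdet_kernel T (M : T -> T -> F) (x : T -> F) (z : T) :
  x z != 0 -> (forall p, \sum_q M p q * x q = 0) -> fdet M = 0.
Proof.
move=> xz0 Mx; rewrite /fdet -det_tr; apply/eqP/det0P.
exists (\row_i x (enum_val i)).
  apply/eqP=> /rowP/(_ (enum_rank z)); rewrite !mxE enum_rankK => xz.
  by rewrite xz eqxx in xz0.
apply/rowP=> i; rewrite !mxE -[RHS](Mx (enum_val i)).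
rewrite [RHS](reindex (@enum_val T predT)) /=; last exact: onW_bij (enum_val_bij _).
by apply: eq_bigr => j _; rewrite !mxE mulrC.
Qed.

Lemma fdet_row_add T (M N : T -> T -> F) (p0 p1 : T) (k : F) :
    p0 != p1 -> (forall p q, p != p0 -> N p q = M p q) ->
    (forall q, N p0 q = M p0 q + k * M p1 q) ->
  fdet N = fdet M.
Proof.
move=> np NM N0; rewrite /fdet.
set A := (X in _ = \det X); set B := (X in \det X = _).
pose i0 := enum_rank p0; pose i1 := enum_rank p1.
have ni : i0 != i1 by rewrite (inj_eq enum_rank_inj).
pose C := \matrix_(i, j) (if i == i0 then A i1 j else A i j).
rewrite (@determinant_multilinear _ _ B A C i0 1 k).
- have -> : \det C = 0; last by rewrite mulr0 addr0 mul1r.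
  apply: (determinant_alternate ni) => j; rewrite !mxE eqxx.
  by rewrite eq_sym (negPf ni).
- by apply/rowP=> j; rewrite !mxE eqxx !enum_rankK N0 mul1r.
- apply/matrixP=> i j; rewrite !mxE NM //.
  by rewrite -(inj_eq enum_rank_inj) enum_valK eq_sym neq_lift.
- apply/matrixP=> i j; rewrite !mxE eq_sym (negPf (neq_lift _ _)) NM //.
  by rewrite -(inj_eq enum_rank_inj) enum_valK eq_sym neq_lift.
Qed.

(** In the term of each permutation the factors [g] and their inverses cancel. *)
Lemma fdet_conj T (M : T -> T -> F) (g : T -> F) : (forall p, g p != 0) ->
  fdet (fun p q => (g p)^-1 * M p q * g q) = fdet M.
Proof.
move=> g0; apply: eq_bigr => s _; congr (_ * _).
under eq_bigr do rewrite mxE.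
rewrite !big_split /=.
have := reindex_inj (@perm_inj _ s) (op := *%R) (x := 1) (P := xpredT) (F := fun j => g (enum_val j)).
move=> /= <-; rewrite mulrAC -big_split /= big1 ?mul1r => [|i _]; last by rewrite mulVf.
by apply: eq_bigr => i _; rewrite mxE.
Qed.

End FinDet.

(** * Cyclic words *)

Local Notation branch D := (crossing D * bool)%type.

Definition other_branch (X : Type) (p : X * bool) : X * bool := (p.1, ~~ p.2).

Lemma prev_rcons_cat (T : eqType) (p z : T) s t : uniq (p :: rcons s z ++ t) ->
  prev (p :: rcons s z ++ t) z = last p s.
Proof.
move=> U; rewrite prev_nth inE mem_cat mem_rcons mem_head /= orbT.
have zs : z \notin s.
  by move: U; rewrite cat_rcons /= cat_uniq => /and4P[_ _]; rewrite /= negb_or => /andP[].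
rewrite cat_rcons index_cat (negPf zs) /= eqxx addn0 (last_nth p).
by rewrite -cat_cons nth_cat ltnS leqnn.
Qed.

Lemma prev_head (T : eqType) (p : T) s : uniq (p :: s) ->
  prev (p :: s) p = last p s.
Proof.
by case/andP=> ps _; rewrite prev_nth mem_head (memNindex ps) (last_nth p).
Qed.

Section CodeBasics.
Variable D : fvcode.
Implicit Types (p q : branch D) (w : seq (branch D)).

Lemma comps_uniq : uniq (flatten (comps D)).
Proof. by rewrite (perm_uniq (comps_perm D)) enum_uniq. Qed.

Lemma mem_comps p : exists2 w, w \in comps D & p \in w.
Proof.
have: p \in flatten (comps D) by rewrite (perm_mem (comps_perm D)) mem_enum.
by case/flattenP=> w wD pw; exists w.
Qed.

Lemma comp_uniq w : w \in comps D -> uniq w.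
Proof.
move=> wD; have := comps_uniq; case/splitPr: wD => l r.
by rewrite flatten_cat /= !cat_uniq => /and3P[_ _ /and3P[]].
Qed.

Lemma word_ofE p w : w \in comps D -> p \in w -> word_of p = w.
Proof.
move=> wD pw; have := comps_uniq; rewrite /word_of; case/splitPr: wD => l r.
rewrite flatten_cat /= cat_uniq => /and3P[_ /hasPn pl _].
rewrite filter_cat (@eq_in_filter _ _ pred0) ?filter_pred0 /= ?pw // => z zl.
apply/negP=> pz; have := pl p; rewrite mem_cat pw => /(_ isT)/negP; apply.
by apply/flattenP; exists z.
Qed.

Lemma nxE p w : w \in comps D -> p \in w -> nx p = next w p.
Proof. by move=> wD pw; rewrite /nx (word_ofE wD pw). Qed.

Lemma pvE p w : w \in comps D -> p \in w -> pv p = prev w p.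
Proof. by move=> wD pw; rewrite /pv (word_ofE wD pw). Qed.

Lemma mem_nx p w : w \in comps D -> (nx p \in w) = (p \in w).
Proof.
move=> wD; have [z zD pz] := mem_comps p; rewrite (nxE zD pz).
have nz : next z p \in z by rewrite mem_next.
apply/idP/idP=> h; [rewrite -(word_ofE wD h) (word_ofE zD nz) //|].
by rewrite -(word_ofE wD h) (word_ofE zD pz).
Qed.

Lemma nxK : cancel (@nx D) (@pv D).
Proof.
move=> p; have [w wD pw] := mem_comps p.
by rewrite (pvE wD) ?mem_nx // (nxE wD pw) prev_next // comp_uniq.
Qed.

Lemma pvK : cancel (@pv D) (@nx D).
Proof.
move=> p; have [w wD pw] := mem_comps p.
by rewrite (pvE wD pw) (nxE wD) ?mem_prev // next_prev // comp_uniq.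
Qed.

Lemma mem_pv p w : w \in comps D -> (pv p \in w) = (p \in w).
Proof. by move=> wD; rewrite -(mem_nx (pv p) wD) pvK. Qed.

Lemma nx_inj : injective (@nx D). Proof. exact: can_inj nxK. Qed.
Lemma pv_inj : injective (@pv D). Proof. exact: can_inj pvK. Qed.

Lemma nx_eq p q : (nx p == q) = (p == pv q).
Proof. by rewrite -[RHS](inj_eq nx_inj) pvK. Qed.

Lemma fconnect_pv p q w : w \in comps D -> p \in w -> q \in w -> fconnect (@pv D) p q.
Proof.
move=> wD pw qw; rewrite (@fconnect_cycle _ _ (rev w)) ?mem_rev //.
rewrite -(@eq_cycle _ (fun x y => (x == nx y))); last first.
  by move=> x y; rewrite eq_sym nx_eq eq_sym.
rewrite rev_cycle.
have : fcycle (next w) w by apply: cycle_next; apply: comp_uniq wD.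
by apply: sub_in_cycle (allss _) => x y xw yw /= /eqP <-; rewrite (nxE wD xw).
Qed.

Lemma other_branchK : involutive (@other_branch (crossing D)).
Proof. by case=> x b; rewrite /other_branch negbK. Qed.

End CodeBasics.

Lemma nx_morph (D D' : fvcode) (g : branch D -> branch D') k :
    injective g ->
    perm_eq (comps D') [seq rot (k w) (map g w) | w <- comps D] ->
  forall p, nx (g p) = g (nx p).
Proof.
move=> g_inj eqD p; have [w wD pw] := mem_comps p.
have gwD : rot (k w) (map g w) \in comps D'.
  by rewrite (perm_mem eqD); apply/mapP; exists w.
have gpw : g p \in rot (k w) (map g w) by rewrite mem_rot map_f.
have Uw := comp_uniq wD.
by rewrite (nxE gwD gpw) next_rot ?map_inj_uniq // (next_map g_inj Uw) (nxE wD pw).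
Qed.

Lemma pv_morph (D D' : fvcode) (g : branch D -> branch D') k :
    injective g ->
    perm_eq (comps D') [seq rot (k w) (map g w) | w <- comps D] ->
  forall p, pv (g p) = g (pv p).
Proof.
move=> g_inj eqD p; apply: nx_inj.
by rewrite pvK (nx_morph g_inj eqD) pvK.
Qed.

Lemma nil_comps_morph (D D' : fvcode) (g : branch D -> branch D') k :
    perm_eq (comps D') [seq rot (k w) (map g w) | w <- comps D] ->
  ([::] \in comps D') = ([::] \in comps D).
Proof.
move=> eqD; rewrite (perm_mem eqD); apply/mapP/idP => [[w wD]|nD]; last first.
  by exists [::].
by move/(congr1 size); rewrite size_rot size_map; case: w wD.
Qed.

(** * Iterating a map up to the first kept element *)

Section FirstKept.
Variables (T : finType) (g : T -> T) (keep : pred T).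

(** Used with [g] equal to [pv] in two ways: keeping the branches that survive a move, the root of
    an edge is the edge of the smaller diagram that contains it; keeping the underpasses, it is the
    start of the long arc. *)
Definition kept_depth z := find keep (orbit g z).
Definition kept_root z := iter (kept_depth z) g z.

Hypothesis reach : forall z, exists k, keep (iter k g z).

Lemma has_orbit_keep z : has keep (orbit g z).
Proof.
have [k kk] := reach z; apply/hasP; exists (iter k g z) => //.
by rewrite -fconnect_orbit fconnect_iter.
Qed.

Lemma kept_depth_order z : (kept_depth z < fingraph.order g z)%N.
Proof. by rewrite -size_orbit -has_find has_orbit_keep. Qed.

Lemma nth_orbit z k : (k < fingraph.order g z)%N -> nth z (orbit g z) k = iter k g z.
Proof. by move=> ltk; rewrite /orbit nth_traject. Qed.

Lemma keep_root z : keep (kept_root z).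
Proof.
have := nth_find z (has_orbit_keep z).
by rewrite nth_orbit // kept_depth_order.
Qed.

Lemma keep_before z k : (k < kept_depth z)%N -> keep (iter k g z) = false.
Proof.
move=> ltk; rewrite -nth_orbit ?before_find //.
exact: ltn_trans ltk (kept_depth_order z).
Qed.

Lemma kept_depthP z k : keep (iter k g z) ->
  (forall j, (j < k)%N -> ~~ keep (iter j g z)) -> kept_depth z = k.
Proof.
move=> kk kj; case: (ltngtP (kept_depth z) k) => // [/kj|/keep_before].
  by rewrite keep_root.
by rewrite kk.
Qed.

Lemma kept_depth0 z : keep z -> kept_depth z = 0%N.
Proof. by move=> kz; apply: kept_depthP. Qed.

Lemma kept_depthS z : ~~ keep z -> kept_depth z = (kept_depth (g z)).+1.
Proof.
move=> nk; apply: kept_depthP => [|[|j] //]; rewrite iterSr; first exact: keep_root.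
by rewrite ltnS => /keep_before->.
Qed.

Lemma kept_root_id z : keep z -> kept_root z = z.
Proof. by move=> kz; rewrite /kept_root kept_depth0. Qed.

Lemma kept_rootS z : ~~ keep z -> kept_root z = kept_root (g z).
Proof. by move=> kz; rewrite /kept_root kept_depthS // iterSr. Qed.

End FirstKept.

Section System.
Variables (F : fieldType) (T : finType) (a b : T -> F) (g h : T -> T).

(** Sums of indicators, so that coefficients add up when [p], [g p] and [h p] coincide. *)
Definition sysmx p q : F :=
  (q == p)%:R - a p * (q == g p)%:R - b p * (q == h p)%:R.

Lemma sum_sysmx p (x : T -> F) :
  \sum_q sysmx p q * x q = x p - a p * x (g p) - b p * x (h p).
Proof.
have pick q0 : \sum_q (q == q0)%:R * x q = x q0.
  rewrite (bigD1 q0) //= eqxx mul1r big1 ?addr0 // => q /negPf->.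
  by rewrite mul0r.
under eq_bigr do rewrite !mulrBl -!mulrA.
by rewrite !sumrB -!mulr_sumr !pick.
Qed.

End System.

(** * Words before and after forgetting crossings *)

Section Forgets.
Variables (D D' : fvcode) (f : crossing D -> crossing D') (Y : {set crossing D'}).
Hypothesis fY : forgets f Y.
Local Notation lf := (lift_branch f).

Lemma lift_branch_inj : injective lf.
Proof. by case: fY => f_inj _ _ _ [x b] [y c] [/f_inj-> ->]. Qed.

Lemma codom_lift_branch z : (z \in codom lf) = (z.1 \notin Y).
Proof.
case: fY => _ fcod _ _; rewrite -fcod; case: z => y b /=.
apply/codomP/codomP => [[[x c] [-> _]]|[x ->]]; first by exists x.
by exists (x, b).
Qed.

Lemma lift_branch_notin p : (lf p).1 \notin Y.
Proof. by rewrite -codom_lift_branch codom_f. Qed.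

Lemma forgets_comp w' : w' \in comps D' ->
  exists2 w, w \in comps D & map lf w = [seq p <- w' | p.1 \notin Y].
Proof.
case: fY => _ _ _ eqc wD'.
have : [seq p <- w' | p.1 \notin Y] \in [seq map lf w | w <- comps D].
  by rewrite eqc map_f.
by case/mapP=> w wD ->; exists w.
Qed.

Lemma comp_forgets w : w \in comps D ->
  exists2 w', w' \in comps D' & map lf w = [seq p <- w' | p.1 \notin Y].
Proof.
case: fY => _ _ _ eqc wD.
have : map lf w \in [seq [seq p <- w' | p.1 \notin Y] | w' <- comps D'].
  by rewrite -eqc map_f.
by case/mapP=> w' wD' ->; exists w'.
Qed.

Local Notation keep := (fun z : branch D' => z.1 \notin Y).
Local Notation root := (kept_root (@pv D') keep).

Hypothesis no_empty : [::] \notin comps D.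

(** A component of [D'] that loses all its crossings would leave an empty word in [D]. *)
Lemma forgets_reach z : exists k, keep (iter k (@pv D') z).
Proof.
have [w' wD' zw] := mem_comps z; have [w wD eqw] := forgets_comp wD'.
have w0 : w != [::] by apply: contraNneq no_empty => <-.
case: w => [//|p w] in wD eqw w0 *.
have : lf p \in [seq p <- w' | p.1 \notin Y] by rewrite -eqw mem_head.
rewrite mem_filter => /andP[kp pw].
suff [k eqk] : exists k, iter k (@pv D') z = lf p by exists k; rewrite eqk.
exists (findex (@pv D') z (lf p)); exact: iter_findex (fconnect_pv wD' zw pw).
Qed.

(** Induction on the prefix [r] of a word rotated to start at the kept branch [p]; the letter taken
    off [r] goes to [t], so the rotated word stays the same. *)
Lemma forgets_root_last p r w' : w' \in comps D' -> p.1 \notin Y ->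
    forall i t, rot i w' = p :: r ++ t ->
  root (last p r) = last p [seq z <- r | z.1 \notin Y].
Proof.
move=> wD' kp i; elim/last_ind: r => [|r z IHr] t eqw.
  by rewrite /= kept_root_id //; apply: forgets_reach.
rewrite last_rcons filter_rcons; case: ifP => kz.
  by rewrite last_rcons kept_root_id //; apply: forgets_reach.
rewrite kept_rootS ?kz //; last exact: forgets_reach.
have zw : z \in w' by rewrite -(mem_rot i) eqw inE mem_cat mem_rcons mem_head orbT.
have Uw := comp_uniq wD'.
have -> : pv z = last p r; last by apply: (IHr (z :: t)); rewrite eqw cat_rcons.
rewrite (pvE wD' zw) -(prev_rot i Uw) eqw prev_rcons_cat //.
by rewrite -eqw rot_uniq.
Qed.

Lemma forgets_root p : root (pv (lf p)) = lf (pv p).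
Proof.
have [w wD pw] := mem_comps p; have [w' wD' eqw] := comp_forgets wD.
have Uw := comp_uniq wD; have Uw' := comp_uniq wD'.
have : lf p \in [seq z <- w' | z.1 \notin Y] by rewrite -eqw map_f.
rewrite mem_filter => /andP[kp pw'].
rewrite (pvE wD pw) (pvE wD' pw') -(prev_map lift_branch_inj Uw) eqw.
have Ufw : uniq [seq z <- w' | z.1 \notin Y] by rewrite filter_uniq.
case/splitPr: pw' wD' Uw' Ufw {eqw} => l r wD' Uw' Ufw.
set w2 := l ++ _ in wD' Uw' Ufw *.
have eqr : rot (size l) w2 = lf p :: r ++ l by rewrite rot_size_cat.
rewrite -(prev_rot (size l) Uw') eqr prev_head -?eqr ?rot_uniq //.
rewrite (@forgets_root_last (lf p) (r ++ l) w2 wD' kp (size l) [::]) ?cats0 //.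
have eqf : [seq z <- w2 | z.1 \notin Y] =
    [seq z <- l | z.1 \notin Y] ++ lf p :: [seq z <- r | z.1 \notin Y].
  by rewrite /w2 filter_cat /= (kp : f p.1 \notin Y).
rewrite -(prev_rot (size [seq z <- l | z.1 \notin Y]) Ufw) eqf rot_size_cat.
by rewrite prev_head ?filter_cat // -cat_cons uniq_catC -eqf.
Qed.

End Forgets.

(** * The determinant of a code *)

Lemma prod_branches (F : fieldType) (X : finType) (Y : {set X}) (G : X * bool -> F) :
  \prod_(z | z.1 \in Y) G z = \prod_(x in Y) (G (x, true) * G (x, false)).
Proof.
transitivity (\prod_(x in Y) \prod_(b : bool) G (x, b)); last first.
  by apply: eq_bigr => x _; rewrite big_bool.
by rewrite pair_big_dep; apply: eq_big => [[x b] | [x b] _] //=; rewrite andbT.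
Qed.

Section CodeDet.
Variable F : fieldType.
Implicit Types (a b : crossing_kind -> bool -> F) (D : fvcode).

(** Row [p] is the equation of the edge leaving [p]. At an underpass the overcrossing arc is
    represented by its edge entering the crossing. *)
Definition code_mx a b D : branch D -> branch D -> F :=
  sysmx (fun p => a (kind p.1) p.2) (fun p => b (kind p.1) p.2)
    (@pv D) (fun p => pv (other_branch p)).

(* A component without crossings is a free generator, hence the value 0. *)
Definition code_det a b D : F :=
  if [::] \in comps D then 0 else fdet (@code_mx a b D).

Lemma sum_code_mx a b D (p : branch D) (x : branch D -> F) :
  \sum_q code_mx a b p q * x q
    = x p - a (kind p.1) p.2 * x (pv p) - b (kind p.1) p.2 * x (pv (other_branch p)).
Proof. exact: sum_sysmx. Qed.

Lemma isotopic_code_det a b D D' : isotopic D D' ->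
  code_det a b D' = code_det a b D.
Proof.
case=> f [k [f_bij fk eqD]].
have lf_inj : injective (lift_branch f).
  by move=> [x c] [y e] [/(bij_inj f_bij)-> ->].
have lf_bij : bijective (lift_branch f).
  by case: f_bij => g fK gK; exists (lift_branch g) => -[x c]; rewrite /lift_branch /= ?fK ?gK.
pose k' (w : seq (branch D)) := k w.
rewrite /code_det (nil_comps_morph (k := k') eqD); case: ifP => // _.
rewrite -(fdet_bij _ lf_bij); apply: eq_fdet => p q.
have lfo z : other_branch (lift_branch f z) = lift_branch f (other_branch z) by [].
rewrite /code_mx /sysmx lfo !(pv_morph (k := k') lf_inj eqD) !(inj_eq lf_inj).
by rewrite /= fk.
Qed.

(* A solution [y] on [D], extended along the removed crossings, need not solve
   the equations of [M] there; [adj y] is the corrected solution. *)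
Lemma forgets_code_det a b (D D' : fvcode) (f : crossing D -> crossing D')
    (Y : {set crossing D'}) (M : branch D' -> branch D' -> F)
    (adj : (branch D' -> F) -> branch D' -> F) (c : F) :
    forgets f Y ->
    (forall y p, adj y (lift_branch f p) = y (lift_branch f p)) ->
    (forall y, (forall z, z.1 \in Y -> y z = y (pv z)) ->
      [/\ (forall z, adj y z = 0) -> (forall z, z.1 \in Y -> y z = 0),
          forall z, z.1 \in Y -> \sum_q M z q * adj y q = 0
        & forall p, let q := lift_branch f p in
          \sum_z M q z * adj y z = y q - a (kind q.1) q.2 * y (pv q)
            - b (kind q.1) q.2 * y (pv (other_branch q))]) ->
    (forall d : branch D' -> nat, (forall z, z.1 \in Y -> d (pv z) < d z)%N ->
      exists2 r : branch D' -> nat,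
        forall z z', z.1 \in Y -> z'.1 \in Y -> z != z' -> M z z' != 0 ->
          (r z' < r z)%N
        & \prod_(z | z.1 \in Y) M z z = c) ->
  (if [::] \in comps D' then 0 else fdet M) = c * code_det a b D.
Proof.
move=> fY adjf adjP rP; rewrite /code_det.
have [fk _] : preserves_kind f /\ True by case: fY.
have [nD'|nD'] := boolP ([::] \in comps D').
  have [w wD /esym/eqP] := forgets_comp fY nD'.
  by rewrite /= eq_sym -size_eq0 size_map size_eq0 => /eqP w0; rewrite -w0 wD mulr0.
have [nD|nD] := boolP ([::] \in comps D).
  rewrite mulr0; have [w' wD' /esym/eqP] := comp_forgets fY nD.
  rewrite -size_eq0 size_filter -leqn0 leqNgt -has_count => /hasPn wY.
  have w0 : w' != [::] by apply: contraNneq nD' => <-.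
  case: w' => [//|z0 w] in wD' wY w0 *.
  (* All crossings of this component are removed, so its indicator, once corrected, is a nonzero
     kernel vector of [M]; both sides are 0. *)
  pose y z : F := (z \in z0 :: w)%:R.
  have yY z : z.1 \in Y -> y z = y (pv z) by rewrite /y mem_pv.
  have [adj0 MY MK] := adjP y yY.
  have [/forallP adjy0|/forallPn[z adjz]] := boolP [forall z, adj y z == 0].
    have z0Y := wY z0 (mem_head _ _); rewrite negbK in z0Y.
    have /eqP := adj0 (fun z => elimT eqP (adjy0 z)) z0 z0Y.
    by rewrite /y mem_head oner_eq0.
  apply: (fdet_kernel adjz) => p.
  have [/MY //|] := boolP (p.1 \in Y).
  rewrite -(codom_lift_branch fY) => /codomP[q ->]; rewrite MK /y.
  have nw z' : (lift_branch f z' \in z0 :: w) = false.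
    by apply/negP=> /wY; rewrite negbK (negPf (lift_branch_notin fY z')).
  rewrite !mem_pv // (_ : other_branch _ = lift_branch f (other_branch q)) //.
  by rewrite !nw !mulr0 !subr0.
pose keep (z : branch D') := z.1 \notin Y; pose g := @pv D'.
have reach := forgets_reach fY nD.
pose root := kept_root g keep; pose d := kept_depth g keep.
have [|r r_lt <-] := rP d.
  by move=> z zY; rewrite /d [X in (_ < X)%N]kept_depthS // /keep zY.
(* Before correction, this is the indicator of the edges of [D'] that make up the edge [s] of
   [D]. *)
pose X z s := adj (fun z => (root z == lift_branch f s)%:R) z.
have lf_inj := lift_branch_inj fY.
have rootf s : root (lift_branch f s) = lift_branch f s.
  by rewrite /root kept_root_id // /keep lift_branch_notin.
have rootpv s : root (pv (lift_branch f s)) = lift_branch f (pv s).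
  exact: forgets_root fY nD s.
have yP s z : z.1 \in Y ->
    (root z == lift_branch f s)%:R = (root (pv z) == lift_branch f s)%:R :> F.
  by move=> zY; rewrite /root kept_rootS // /keep zY.
rewrite (@fdet_elim F _ _ M (lift_branch f) X r (@code_mx a b D)) //.
- by congr (_ * _); apply: eq_bigl => z; rewrite (codom_lift_branch fY) negbK.
- by move=> s s'; rewrite /X adjf rootf (inj_eq lf_inj).
- move=> z s; rewrite (codom_lift_branch fY) negbK => zY.
  by have [_ MY _] := adjP _ (yP s); apply: MY.
- move=> p s; have [_ _ MK] := adjP _ (yP s); rewrite /X MK /code_mx /sysmx.
  have -> : other_branch (lift_branch f p) = lift_branch f (other_branch p) by [].
  by rewrite !rootpv rootf !(inj_eq lf_inj) ![_ == s]eq_sym /= fk.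
- move=> z z'; rewrite !(codom_lift_branch fY) !negbK; exact: r_lt.
Qed.

Lemma code_mx_diag a b D (p : branch D) : pv p != p -> pv (other_branch p) != p ->
  code_mx a b p p = 1.
Proof.
move=> n1 n2; rewrite /code_mx /sysmx eqxx ![p == _]eq_sym (negPf n1) (negPf n2).
by rewrite !mulr0 !subr0.
Qed.

Lemma code_mx_neq0 a b D (p q : branch D) : p != q -> code_mx a b p q != 0 ->
  q = pv p \/ b (kind p.1) p.2 != 0 /\ q = pv (other_branch p).
Proof.
rewrite /code_mx /sysmx eq_sym => /negPf->; rewrite sub0r.
have [->|_] := eqVneq q (pv p); first by left.
have [->|_] := eqVneq q (pv (other_branch p)).
  have [->|b0] := eqVneq (b (kind p.1) p.2) 0; last by right.
  by rewrite mulr0 mul0r !oppr0 addr0 eqxx.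
by rewrite !mulr0 !oppr0 addr0 eqxx.
Qed.

Lemma reidemeister1_code_det a b D D' :
    (forall o c, a (Classical o) c + b (Classical o) c = 1) ->
  reidemeister1 D D' ->
  exists (o c : bool), code_det a b D' = a (Classical o) c * code_det a b D.
Proof.
move=> ab1 [f [x [c [kx nxx fY]]]].
have pvx : pv (x, ~~ c) = (x, c) by rewrite -nxx nxK.
have [o ko] : exists o, kind x = Classical o by case: (kind x) kx => // o; exists o.
exists o, c; rewrite {1}/code_det.
apply: (forgets_code_det (adj := fun y => y) fY) => // [y yY|d dP].
  split=> // [z|p /=]; last by rewrite sum_code_mx.
  case: z => x' c'; rewrite inE /= => /eqP ->; rewrite sum_code_mx /= ko.
  have yE : y (x, c) = y (pv (x, c)) by rewrite yY ?inE /=.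
  have yG : y (x, ~~ c) = y (x, c) by rewrite yY ?inE /= ?pvx.
  have yy e : y (x, e) = y (pv (x, c)) /\ y (pv (x, e)) = y (pv (x, c)).
    case: (eqVneq e c) => [->|nec]; first by rewrite -yE.
    have -> : e = ~~ c by case: (e) (c) nec => [] [].
    by rewrite pvx yG -yE.
  have [-> ->] := yy c'; have [_ ->] := yy (~~ c').
  by rewrite -addrA -opprD -mulrDl ab1 mul1r subrr.
have d1 : (d (pv (x, c)) < d (x, c))%N by apply: dP; rewrite inE.
have d2 : (d (x, c) < d (x, ~~ c))%N by rewrite -pvx; apply: dP; rewrite inE.
exists d => [[x1 c1] [x2 c2]|].
  rewrite !inE /= => /eqP-> /eqP-> ne /(code_mx_neq0 ne)[->|[_ eq2]].
    by apply: dP; rewrite inE.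
  move: eq2 ne; rewrite /other_branch /=; case: (eqVneq c1 c) => [->|nc].
    by rewrite pvx => -[->]; rewrite eqxx.
  have -> : c1 = ~~ c by case: (c1) (c) nc => [] [].
  by rewrite negbK => -> _; apply: ltn_trans d1 d2.
rewrite prod_branches big_set1.
have Mg : code_mx a b (x, ~~ c) (x, ~~ c) = 1.
  apply: code_mx_diag; first by rewrite pvx; case: (c); apply/eqP => -[].
  rewrite /other_branch /= negbK; apply/eqP => eqp.
  by have := ltn_trans d1 d2; rewrite eqp ltnn.
have Me : code_mx a b (x, c) (x, c) = a (Classical o) c.
  rewrite /code_mx /sysmx /other_branch /= pvx eqxx ko.
  have -> : ((x, c) == pv (x, c)) = false by apply/eqP=> eqp; rewrite -eqp ltnn in d1.
  by rewrite mulr0 mulr1 subr0 -(ab1 o c) addrK.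
by case: (c) Mg Me => /= -> ->; rewrite ?mulr1 ?mul1r.
Qed.

(* The two sides of the bigon run from [s1] to [e1] and from [s2] to [e2]. *)
Lemma bigon_code_det a b D D' (f : crossing D -> crossing D') Y s1 e1 s2 e2
    (l1 l2 : F) :
    forgets f Y -> (forall z, z.1 \in Y -> z \in [:: s1; e1; s2; e2]) ->
    uniq [:: s1; e1; s2; e2] -> all (fun z => z.1 \in Y) [:: s1; e1; s2; e2] ->
    pv e1 = s1 -> pv e2 = s2 -> l1 != 0 -> l2 != 0 ->
    a (kind s1.1) s1.2 = l1 -> a (kind e1.1) e1.2 = l1^-1 ->
    a (kind s2.1) s2.2 = l2 -> a (kind e2.1) e2.2 = l2^-1 ->
    (forall z, z.1 \in Y -> b (kind z.1) z.2 = 0) ->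
  code_det a b D' = code_det a b D.
Proof.
move=> fY Y4 U4 /and5P[Ys1 Ye1 Ys2 Ye2 _] pe1 pe2 l10 l20 as1 ae1 as2 ae2 b0.
rewrite {1}/code_det -[RHS]mul1r.
(* The first corner of a side multiplies the entering value by [l1] or [l2], and the second corner
   restores it. *)
pose adj (y : branch D' -> F) z :=
  if z == s1 then l1 * y z else if z == s2 then l2 * y z else y z.
have adjN y z : z.1 \notin Y -> adj y z = y z.
  move=> zY; rewrite /adj; case: eqP zY => [->|_]; first by rewrite Ys1.
  by case: eqP => [->|//]; rewrite Ys2.
have /and5P[/and3P[n1 n5 n2] /andP[n3 _] n4 _ _] : [&& [&& s1 != e1, s1 != s2 & s1 != e2],
    (e1 != s2) && (e1 != e2), s2 != e2, true & true].
  by move: U4; rewrite /= !inE !negb_or !andbT.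
rewrite eq_sym in n1; rewrite eq_sym in n2; rewrite eq_sym in n4; rewrite eq_sym in n5.
have adjpv y z : z != e1 -> z != e2 -> adj y (pv z) = y (pv z).
  move=> z1 z2; rewrite /adj.
  have -> : (pv z == s1) = false by rewrite -pe1 (inj_eq (@pv_inj _)) (negPf z1).
  by have -> : (pv z == s2) = false by rewrite -pe2 (inj_eq (@pv_inj _)) (negPf z2).
apply: (forgets_code_det (adj := adj) fY) => [y p|y yY|d dP].
- by rewrite adjN // (lift_branch_notin fY).
- split=> [adj0 z zY|z zY|p].
  + have := adj0 z; rewrite /adj; case: ifP => _.
      by move/eqP; rewrite mulf_eq0 (negPf l10) => /eqP.
    case: ifP => // _.
    by move/eqP; rewrite mulf_eq0 (negPf l20) => /eqP.
  + rewrite sum_code_mx b0 // mul0r subr0; move: (Y4 z zY); rewrite !inE.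
    case/or4P=> /eqP->.
    * by rewrite adjpv 1?eq_sym // {1}/adj eqxx as1 -yY // subrr.
    * rewrite pe1 ae1 {1}/adj (negPf n1) (negPf n3) /adj eqxx mulKf //.
      by rewrite yY // pe1 subrr.
    * rewrite adjpv 1?eq_sym // {1}/adj eqxx (negPf n5) as2 -yY // subrr //.
    * rewrite pe2 ae2 {1}/adj (negPf n2) (negPf n4) /adj eqxx (negPf n5) mulKf //.
      by rewrite yY // pe2 subrr.
  + rewrite /=; have nY z : z.1 \notin Y -> z != e1 /\ z != e2.
      by split; apply: contraNneq H => ->.
    have [m1 m2] := nY _ (lift_branch_notin fY p).
    have [m3 m4] := nY _ (lift_branch_notin fY (other_branch p)).
    rewrite sum_code_mx adjN ?(lift_branch_notin fY) // !adjpv //.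
exists d => [z z' zY z'Y ne /(code_mx_neq0 ne)[->|[]]|]; first exact: dP.
  by rewrite b0 // eqxx.
apply: big1 => z zY; rewrite /code_mx /sysmx eqxx b0 // mul0r subr0.
have -> : (z == pv z) = false by apply/eqP=> eqz; have := dP z zY; rewrite -eqz ltnn.
by rewrite mulr0 subr0.
Qed.

(** The row of [u2] involves the over strand, which may itself come back from [u2], so the removed
    rows need not be triangular. Adding multiples of the rows of [u1] and [o1] turns this row into
    the equation that the values at [u2] and [pv u1] agree; the corrected values then solve a
    triangular system. *)
Lemma classical_bigon_code_det a b D D' (f : crossing D -> crossing D') Y
    o1 o2 u1 u2 (tau : F) :
    forgets f Y -> (forall z, z.1 \in Y -> z \in [:: o1; o2; u1; u2]) ->
    uniq [:: o1; o2; u1; u2] -> all (fun z => z.1 \in Y) [:: o1; o2; u1; u2] ->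
    pv o2 = o1 -> pv u2 = u1 -> tau != 0 ->
    (forall z, z \in [:: o1; o2] -> a (kind z.1) z.2 = 1 /\ b (kind z.1) z.2 = 0) ->
    a (kind u1.1) u1.2 = tau -> b (kind u1.1) u1.2 = 1 - tau ->
    a (kind u2.1) u2.2 = tau^-1 -> b (kind u2.1) u2.2 = 1 - tau^-1 ->
    (other_branch u1, other_branch u2) \in [:: (o1, o2); (o2, o1)] ->
  code_det a b D' = code_det a b D.
Proof.
move=> fY Y4 U4 /and5P[Yo1 Yo2 Yu1 Yu2 _] po2 pu2 tau0 abo au1 bu1 au2 bu2 ou.
have /and5P[/and3P[n1 n2 n3] /andP[n4 n5] n6 _ _] : [&& [&& o1 != o2, o1 != u1 & o1 != u2],
    (o2 != u1) && (o2 != u2), u1 != u2, true & true].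
  by move: U4; rewrite /= !inE !negb_or !andbT.
have [[ao1 bo1] [ao2 bo2]] : (a (kind o1.1) o1.2 = 1 /\ b (kind o1.1) o1.2 = 0) /\
    (a (kind o2.1) o2.2 = 1 /\ b (kind o2.1) o2.2 = 0).
  by split; apply: abo; rewrite !inE eqxx ?orbT.
pose M z q : F := if z == u2 then (q == u2)%:R - (q == pv u1)%:R else code_mx a b z q.
have -> : code_det a b D' = if [::] \in comps D' then 0 else fdet M.
  rewrite /code_det; case: ifP => // _; symmetry.
  pose M1 z q := if z == u2 then code_mx a b u2 q + tau^-1 * code_mx a b u1 q
                 else code_mx a b z q.
  (* Once [u1] is cancelled, the row of [u2] still contains the row of [o1] with coefficient
     [1 - tau^-1] up to sign. The sign depends on the direction of the under strand. *)
  pose k : F := if other_branch u1 == o1 then 1 - tau^-1 else tau^-1 - 1.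
  rewrite -(@fdet_row_add _ _ (@code_mx a b D') M1 u2 u1 tau^-1) 1?eq_sym //.
  - apply: (@fdet_row_add _ _ M1 M u2 o1 k) => [|z q /negPf nz|q]; first by rewrite eq_sym.
      by rewrite /M /M1 nz.
    rewrite /M /M1 eqxx (negPf n3) /code_mx /sysmx /k.
    rewrite au1 bu1 au2 bu2 ao1 bo1 pu2.
    move: ou; rewrite !inE !xpair_eqE => /orP[] /andP[/eqP-> /eqP->].
      by rewrite eqxx po2; field.
    by rewrite (eq_sym o2) (negPf n1) po2; field.
  - by move=> z q /negPf nz; rewrite /M1 nz.
  - by move=> q; rewrite /M1 eqxx.
rewrite -[RHS]mul1r.
(* Only the under side of the bigon carries a value different from the entering one; it is given by
   the equation at [u1]. *)
pose adj (y : branch D' -> F) z :=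
  if z == u1 then tau * y (pv u1) + (1 - tau) * y (pv o1) else y z.
have adjn y z : z != u1 -> adj y z = y z by rewrite /adj => /negPf->.
have adjN y z : z.1 \notin Y -> adj y z = y z.
  by move=> zY; apply: adjn; apply: contraNneq zY => ->.
have adjpv y z : z != u2 -> adj y (pv z) = y (pv z).
  by move=> z2; apply: adjn; rewrite -pu2 (inj_eq (@pv_inj _)).
apply: (forgets_code_det (adj := adj) fY) => [y p|y yY|d dP].
- by rewrite adjN // (lift_branch_notin fY).
- have yo : y (pv o1) = y o1 by rewrite -yY.
  have yu : y u2 = y u1 by rewrite yY // pu2.
  split=> [adj0 z zY|z zY|p].
  + have [->|nz] := eqVneq z u1; last by rewrite -(adjn y).
    by rewrite -yu -(adjn y) // eq_sym.
  + have [->|nz] := eqVneq z u2.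
      rewrite /M eqxx; under eq_bigr do rewrite mulrBl.
      have pick q0 : \sum_q (q == q0)%:R * adj y q = adj y q0.
        rewrite (bigD1 q0) //= eqxx mul1r big1 ?addr0 // => q /negPf->.
        by rewrite mul0r.
      rewrite sumrB !pick adjn 1?eq_sym // adjpv //.
      by rewrite yu (yY u1) // subrr.
    under eq_bigr do rewrite /M (negPf nz).
    rewrite sum_code_mx; move: (Y4 z zY); rewrite !inE (negPf nz) orbF.
    case/or3P => /eqP eqz; rewrite {z zY}eqz in nz *.
    * by rewrite ao1 bo1 mul0r subr0 mul1r adjn // adjpv // yo subrr.
    * by rewrite ao2 bo2 mul0r subr0 mul1r adjn // adjpv // -yY // subrr.
    * rewrite au1 bu1 {1}/adj eqxx adjpv //.
      have -> : adj y (pv (other_branch u1)) = y (pv o1).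
        move: ou; rewrite !inE !xpair_eqE => /orP[] /andP[/eqP-> _]; rewrite adjpv //.
        by rewrite po2 yo.
      by rewrite addrAC addrK subrr.
  + rewrite /=.
    have nY z : z.1 \notin Y -> z != u2 by move=> zY; apply: contraNneq zY => ->.
    have m1 := nY _ (lift_branch_notin fY p).
    have m2 := nY _ (lift_branch_notin fY (other_branch p)).
    under eq_bigr do rewrite /M (negPf m1).
    by rewrite sum_code_mx adjN ?(lift_branch_notin fY) // !adjpv.
have dpv z : z.1 \in Y -> pv z != z.
  by move=> zY; apply/eqP=> eqz; have := dP z zY; rewrite eqz ltnn.
have dpv2 z : z.1 \in Y -> (pv z).1 \in Y -> pv (pv z) != z.
  move=> zY pzY; apply/eqP=> eqz; have := ltn_trans (dP _ pzY) (dP _ zY).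
  by rewrite eqz ltnn.
(* After the row operations no other removed row refers to [u1], which can be put on top; the other
   removed rows refer only to edges met earlier on their own strand. *)
pose r z := if z == u1 then (\sum_z d z).+1 else d z.
exists r => [z z' zY z'Y ne|].
  have [eqz|nz1] := eqVneq z u1.
    have nz' : z' != u1 by rewrite eq_sym -eqz.
    by move=> _; rewrite /r eqz eqxx (negPf nz') ltnS (bigD1 z') //= leq_addr.
  have [eqz|nz2] := eqVneq z u2.
    have nz' : z' != u2 by rewrite eq_sym -eqz.
    rewrite {1}/M eqz eqxx (negPf nz') /r.
    have [-> _|_] := eqVneq z' (pv u1); last by rewrite subrr eqxx.
    rewrite (negPf (dpv u1 Yu1)) (eq_sym u2) (negPf n6).
    by apply: ltn_trans (dP _ Yu1) _; rewrite -{1}pu2 dP.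
  rewrite {1}/M (negPf nz2) => /(code_mx_neq0 ne).
  have [_ bz] : a (kind z.1) z.2 = 1 /\ b (kind z.1) z.2 = 0.
    by apply: abo; move: (Y4 z zY); rewrite !inE (negPf nz1) (negPf nz2) !orbF.
  rewrite bz eqxx => -[->|[]//]; rewrite /r (negPf nz1) -pu2 (inj_eq (@pv_inj _)).
  by rewrite (negPf nz2) dP.
apply: big1 => z zY; have [->|nz2] := eqVneq z u2.
  rewrite /M eqxx; have := dpv2 _ Yu2; rewrite pu2 eq_sym => /(_ Yu1) /negPf->.
  by rewrite subr0.
rewrite /M (negPf nz2) /code_mx /sysmx eqxx (eq_sym z) (negPf (dpv z zY)) mulr0 subr0.
have [->|nz1] := eqVneq z u1.
  have -> : (u1 == pv (other_branch u1)) = false.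
    move: ou; rewrite !inE !xpair_eqE => /orP[] /andP[/eqP-> _].
      by rewrite -pu2 (inj_eq (@pv_inj _)) eq_sym (negPf n3).
    by rewrite po2 eq_sym (negPf n2).
  by rewrite mulr0 subr0.
have [_ ->] : a (kind z.1) z.2 = 1 /\ b (kind z.1) z.2 = 0.
  by apply: abo; move: (Y4 z zY); rewrite !inE (negPf nz1) (negPf nz2) !orbF.
by rewrite mul0r subr0.
Qed.

End CodeDet.

(** * Weights *)

Section Weights.
Variables (F : fieldType) (t u v : F).
Hypotheses (t0 : t != 0) (u0 : u != 0) (v0 : v != 0).

(** This is [t] to the power of the writhe, [Classical true] being a negative crossing. *)
Definition under_wt (o : bool) : F := if o then t^-1 else t.

Definition along_wt (k : crossing_kind) (b : bool) : F :=
  match k with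
  | Classical o => if b == o then 1 else under_wt o
  | Flat => if b then u else u^-1
  | Virtual => if b then v else v^-1
  end.

Definition over_wt (k : crossing_kind) (b : bool) : F :=
  if k is Classical o then if b == o then 0 else 1 - under_wt o else 0.

(** Every crossing is rescaled, not only the virtual ones, because the numbering of the faces jumps
    across every strand. The weight of a virtual crossing becomes 1. *)
Definition gauged_wt (k : crossing_kind) (b : bool) : F :=
  along_wt k b * (if b then v^-1 else v).

Lemma along_over_wt o c : along_wt (Classical o) c + over_wt (Classical o) c = 1.
Proof. by rewrite /=; case: (c == o); [rewrite addr0 | rewrite addrC subrK]. Qed.

Lemma under_wt_neq0 o : under_wt o != 0.
Proof. by case: o; rewrite /= ?invr_eq0. Qed.

Lemma under_wtN o : under_wt (~~ o) = (under_wt o)^-1.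
Proof. by case: o; rewrite /= ?invrK. Qed.

Lemma mem_bigon (X : finType) (x y : X) (b : bool) (z : X * bool) :
  z.1 \in [set x; y] -> z \in [:: (x, b); (y, ~~ b); (x, ~~ b); (y, b)].
Proof.
case: z => z c; rewrite !inE /= !xpair_eqE.
by case/orP=> /eqP->; rewrite eqxx /=; case: b c => -[]; rewrite ?orbT.
Qed.

(** Opposite branch values at the two corners of a strand make its weights inverse to each other:
    [u] and [u^-1] in a flat bigon, [t] and [t^-1] on the under side of a classical one. What
    remains is to tell which side is over and in which direction the second side runs. *)
Lemma reidemeister2_code_det D D' : reidemeister2 D D' ->
  code_det along_wt over_wt D' = code_det along_wt over_wt D.
Proof.
case=> f [x [y [b [nxy kxy nx1 nx2 fY]]]].
have pv1 : pv (y, ~~ b) = (x, b) by rewrite -nx1 nxK.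
have nyx : (y == x) = false by rewrite eq_sym (negPf nxy).
have Us (s : seq (branch D')) :
    perm_eq s [:: (x, b); (y, ~~ b); (x, ~~ b); (y, b)] -> uniq s.
  move/perm_uniq->; rewrite /= !inE !xpair_eqE !eqxx nyx (negPf nxy) /=.
  by case: (b).
have As (s : seq (branch D')) :
    perm_eq s [:: (x, b); (y, ~~ b); (x, ~~ b); (y, b)] ->
    all (fun z => z.1 \in [set x; y]) s.
  by move/perm_all->; rewrite /= !inE !eqxx ?orbT.
have Ms (s : seq (branch D')) :
    perm_eq s [:: (x, b); (y, ~~ b); (x, ~~ b); (y, b)] ->
    forall z, z.1 \in [set x; y] -> z \in s.
  by move=> ps z /mem_bigon; rewrite (perm_mem ps).
case: kxy => [[o [kx ky]]|[fx fy]]; last first.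
  have kx : kind x = Flat by move: fx; rewrite /is_flat; case: (kind x).
  have ky : kind y = Flat by move: fy; rewrite /is_flat; case: (kind y).
  have uV (c : bool) : (if ~~ c then u else u^-1) = (if c then u else u^-1)^-1.
    by case: c; rewrite /= ?invrK.
  have wV (c : bool) : (if c then u else u^-1) != 0 by case: c; rewrite ?invr_eq0.
  have bY z : z.1 \in [set x; y] -> over_wt (kind z.1) z.2 = 0.
    by rewrite !inE => /orP[] /eqP->; rewrite ?kx ?ky.
  case: nx2 => nx2; have pv2 := congr1 (@pv D') nx2; rewrite nxK in pv2.
    have ps : perm_eq [:: (x, b); (y, ~~ b); (x, ~~ b); (y, b)]
                      [:: (x, b); (y, ~~ b); (x, ~~ b); (y, b)] by [].
    by apply: (bigon_code_det fY (Ms _ ps) (Us _ ps) (As _ ps) pv1 (esym pv2) (wV b) (wV (~~ b)) _ _ _ _ bY);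
      rewrite /= ?kx ?ky /= ?uV ?invrK.
  have ps : perm_eq [:: (x, b); (y, ~~ b); (y, b); (x, ~~ b)]
                    [:: (x, b); (y, ~~ b); (x, ~~ b); (y, b)].
    by rewrite !perm_cons -(perm_rot 1 [:: (y, b); _]).
  by apply: (bigon_code_det fY (Ms _ ps) (Us _ ps) (As _ ps) pv1 (esym pv2) (wV b) (wV b) _ _ _ _ bY);
    rewrite /= ?kx ?ky /= ?uV ?invrK.
have nbb : (~~ b == b) = false by case: (b).
have nbb' : (b == ~~ b) = false by case: (b).
(* The side from [(x, b)] to [(y, ~~ b)] is over in the first case and under in the second. *)
have [ob|ob] : o = b \/ o = ~~ b by case: (o) (b) => -[]; auto.
  have ov z : z \in [:: (x, b); (y, ~~ b)] ->
      along_wt (kind z.1) z.2 = 1 /\ over_wt (kind z.1) z.2 = 0.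
    by rewrite !inE => /orP[] /eqP->; rewrite /= ?kx ?ky /= ob eqxx.
  case: nx2 => nx2; have pv2 := congr1 (@pv D') nx2; rewrite nxK in pv2.
    have ps : perm_eq [:: (x, b); (y, ~~ b); (x, ~~ b); (y, b)]
                      [:: (x, b); (y, ~~ b); (x, ~~ b); (y, b)] by [].
    apply: (classical_bigon_code_det fY (Ms _ ps) (Us _ ps) (As _ ps) pv1 (esym pv2) (under_wt_neq0 b) ov);
      rewrite /= ?kx ?ky /= ?ob ?nbb ?nbb' ?under_wtN //.
    by rewrite !inE /other_branch /= negbK !eqxx.
  have ps : perm_eq [:: (x, b); (y, ~~ b); (y, b); (x, ~~ b)]
                    [:: (x, b); (y, ~~ b); (x, ~~ b); (y, b)].
    by rewrite !perm_cons -(perm_rot 1 [:: (y, b); _]).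
  apply: (classical_bigon_code_det fY (Ms _ ps) (Us _ ps) (As _ ps) pv1 (esym pv2) (under_wt_neq0 (~~ b)) ov);
    rewrite /= ?kx ?ky /= ?ob ?nbb ?nbb' ?under_wtN ?invrK //.
  by rewrite !inE /other_branch /= negbK !eqxx orbT.
case: nx2 => nx2; have pv2 := congr1 (@pv D') nx2; rewrite nxK in pv2.
  have ps : perm_eq [:: (x, ~~ b); (y, b); (x, b); (y, ~~ b)]
                    [:: (x, b); (y, ~~ b); (x, ~~ b); (y, b)].
    by rewrite -(perm_rot 2).
  have ov z : z \in [:: (x, ~~ b); (y, b)] ->
      along_wt (kind z.1) z.2 = 1 /\ over_wt (kind z.1) z.2 = 0.
    by rewrite !inE => /orP[] /eqP->; rewrite /= ?kx ?ky /= ob ?negbK eqxx.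
  apply: (classical_bigon_code_det fY (Ms _ ps) (Us _ ps) (As _ ps) (esym pv2) pv1 (under_wt_neq0 (~~ b)) ov);
    rewrite /= ?kx ?ky /= ?ob ?nbb ?nbb' ?negbK ?nbb ?nbb' ?under_wtN ?invrK //.
  by rewrite !inE /other_branch /= negbK !eqxx.
have ps : perm_eq [:: (y, b); (x, ~~ b); (x, b); (y, ~~ b)]
                  [:: (x, b); (y, ~~ b); (x, ~~ b); (y, b)].
  by rewrite -(perm_rot 2) /= !perm_cons -(perm_rot 1 [:: (y, b); _]).
have ov z : z \in [:: (y, b); (x, ~~ b)] ->
    along_wt (kind z.1) z.2 = 1 /\ over_wt (kind z.1) z.2 = 0.
  by rewrite !inE => /orP[] /eqP->; rewrite /= ?kx ?ky /= ob ?negbK eqxx.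
apply: (classical_bigon_code_det fY (Ms _ ps) (Us _ ps) (As _ ps) (esym pv2) pv1 (under_wt_neq0 (~~ b)) ov);
  rewrite /= ?kx ?ky /= ?ob ?nbb ?nbb' ?negbK ?nbb ?nbb' ?under_wtN ?invrK //.
by rewrite !inE /other_branch /= negbK !eqxx orbT.
Qed.

(* With the weights gauged, virtual crossings become transparent. *)
Lemma detour_gauged_code_det D1 D2 : detour D1 D2 ->
  code_det gauged_wt over_wt D1 = code_det gauged_wt over_wt D2.
Proof.
case=> E [f1 [f2 [s1 [w1 [r1 [s2 [w2 [r2 [[eq1 eq2] vs1 vs2 fg1 fg2]]]]]]]]].
suff forget D (f : crossing E -> crossing D) (s : seq (branch D)) :
    all (fun p => is_virtual p.1) s -> forgets f [set x | x \in map fst s] ->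
    code_det gauged_wt over_wt D = code_det gauged_wt over_wt E.
  by rewrite (forget _ _ _ vs1 fg1) (forget _ _ _ vs2 fg2).
move=> vs fY {s1 s2 f1 f2 w1 w2 r1 r2 eq1 eq2 vs1 vs2 fg1 fg2}.
have kY z : z \in [set x | x \in map fst s] -> kind z = Virtual.
  rewrite inE => /mapP[p /(allP vs) pv ->]; move: pv; rewrite /is_virtual.
  by case: (kind p.1).
have gV b : gauged_wt Virtual b = 1.
  by rewrite /gauged_wt /=; case: b; rewrite ?mulfV ?mulVf.
rewrite {1}/code_det -[RHS]mul1r.
apply: (forgets_code_det (adj := fun y => y) fY) => // [y yY|d dP].
  split=> // [z zY|p /=]; last by rewrite sum_code_mx.
  by rewrite sum_code_mx kY // gV mul1r mul0r subr0 -yY // subrr.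
exists d => [z z' zY z'Y ne /(code_mx_neq0 ne)[->|[]]|].
- exact: dP.
- by rewrite kY //= eqxx.
apply: big1 => z zY; rewrite /code_mx /sysmx eqxx kY // mul0r subr0.
have -> : (z == pv z) = false by apply/eqP=> eqz; have := dP z zY; rewrite -eqz ltnn.
by rewrite mulr0 subr0.
Qed.

(* [h] is an Alexander numbering of the faces, read off at the crossings. *)
Lemma gauged_code_det D (h : crossing D -> int) :
    (forall p, h (nx p).1 - h p.1 = (p.2 : nat)%:Z - (~~ (nx p).2 : nat)%:Z) ->
  code_det gauged_wt over_wt D = code_det along_wt over_wt D.
Proof.
move=> hP; rewrite /code_det; case: ifP => // _.
(* If [h] is the number of the face on the right of both strands at the crossing, the exponent is
   the number of the face on the right of the edge leaving [p], the left face having one more. *)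
pose g (p : branch D) : F := v ^ (h p.1 + (p.2 : nat)%:Z).
have g0 p : g p != 0 by rewrite expfz_neq0.
rewrite -[RHS](@fdet_conj _ _ _ g) //; apply: eq_fdet => p q.
have gpv z : g (pv z) = v ^ (h z.1 + (~~ z.2 : nat)%:Z).
  have hz := hP (pv z); rewrite pvK in hz.
  by rewrite /g; apply: (congr1 (exprz v)); lia.
have split3 (A B C x y z k : F) : x * (A - B * y - C * z) * k
    = x * A * k - x * B * y * k - x * C * z * k by ring.
rewrite /code_mx /sysmx split3 {split3}; congr (_ - _ - _).
- by have [->|_] := eqVneq q p; rewrite ?mulr1 ?mulVf ?mulr0 ?mul0r.
- have [->|_] := eqVneq q (pv p); last by rewrite !mulr0 mul0r.
  rewrite !mulr1 gpv /gauged_wt /g mulrAC [RHS]mulrC; congr (_ * _).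
  rewrite invr_expz -expfzDr //.
  case: (p.2) => /=; rewrite ?addr0.
    by rewrite (_ : _ + _ = -1) ?exprN1 //; lia.
  by rewrite (_ : _ + _ = 1) ?expr1z //; lia.
(* The edge entering along the other branch and the edge leaving along [p] have the same exponent,
   so [over_wt] needs no gauged version. *)
- have [->|_] := eqVneq q (pv (other_branch p)); last by rewrite !mulr0 mul0r.
  rewrite !mulr1 gpv /g mulrAC /= negbK mulVf ?mul1r //.
  by rewrite expfz_neq0.
Qed.

End Weights.

(** * Alexander numbering of a plane diagram *)

Section Planar.
Import Order.TTheory Num.Theory.
Variable D : fvcode.
Local Notation dart := (branch D * bool)%type.
Local Notation fn := (@face_next D).

Lemma face_next_inj : injective fn.
Proof.
have E x : ~~ x = true -> x = false by case: x.
move=> [p fp] [q fq]; rewrite /face_next.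
have pvE2 (x y : crossing D) e e' : pv (x, e) = pv (y, e') -> x = y.
  by move/pv_inj => -[].
case: fp; case: fq.
- have [->//|ne] := eqVneq p q.
  have : nx p != nx q by rewrite (inj_eq (@nx_inj _)).
  case: (nx p) (nx q) => [x []] [y []] //= nne.
    by move=> [/pvE2 exy]; rewrite exy eqxx in nne.
  by move=> [exy]; rewrite exy eqxx in nne.
- case: (nx p) => [x []] /=; case: q => [y []] //=.
  by move=> [/pv_inj [_]].
- case: (nx q) => [y []] /=; case: p => [x []] //=.
  by move=> [/pv_inj [_]].
- case: p => [x []] /=; case: q => [y []] //=.
    by move=> [->].
  by move=> [/pvE2 ->].
Qed.

Local Notation face := (froot fn).

Lemma face_nextE d : face (fn d) = face d.
Proof.
apply/esym/eqP; rewrite root_connect; first exact: fconnect1.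
exact: fconnect_sym face_next_inj.
Qed.

Lemma adjacent_sym : connect_sym (@adjacent D).
Proof.
apply: sym_connect_sym => x y; rewrite /adjacent.
by apply: eq_existsb => b; rewrite orbC.
Qed.

(** Summation around a face, regrouped by corners: the end of a dart is put together with the
    beginning of the next one, and the corner terms telescope. *)
Lemma face_sum_eq0 (s hd tl g : dart -> rat) (phi : dart) :
    (forall d, s d = tl d + hd d) ->
    (forall d, hd d + tl (fn d) = g d - g (fn d)) ->
  \sum_(d | face d == phi) s d = 0.
Proof.
move=> sE hE; under eq_bigr do rewrite sE.
have shift (k : dart -> rat) :
    \sum_(d | face d == phi) k (fn d) = \sum_(d | face d == phi) k d.
  rewrite [RHS](reindex_inj face_next_inj) /=.
  by apply: eq_bigl => d; rewrite face_nextE.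
rewrite big_split /= -(shift tl) addrC -big_split /=.
by under eq_bigr do rewrite hE; rewrite sumrB shift subrr.
Qed.

Lemma const_on_comps (T : eqType) (k : crossing D -> T) :
    (forall p, k (nx p).1 = k p.1) ->
  forall x, k (fingraph.root (@adjacent D) x) = k x.
Proof.
move=> kE x; have := connect_root (@adjacent D) x.
move: (fingraph.root _ x) => y; rewrite (@eq_connect _ _ (fun x y => adjacent x y)) //.
case/connectP=> s; elim: s x => [|z s IHs] x /=; first by move=> _ ->.
case/andP=> /existsP[b /orP[/eqP exz|/eqP ezx]] zP eqy; rewrite (IHs z zP eqy).
  by rewrite -exz kE.
by rewrite -ezx kE.
Qed.

Local Notation Roots := (predI (fingraph.roots (@adjacent D)) (mem {: crossing D})).
Local Notation Faces := (predI (froots fn) (mem {: dart})).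

Lemma const_on_comps_eq0 (k : crossing D -> rat) :
    (forall p, k (nx p).1 = k p.1) ->
    (forall i : 'I_#|Roots|, k (enum_val i) = 0) ->
  forall x, k x = 0.
Proof.
move=> kE k0 x; rewrite -const_on_comps //.
have xr : fingraph.root (@adjacent D) x \in Roots by rewrite !inE roots_root //; exact: adjacent_sym.
by rewrite -(enum_rankK_in xr xr) k0.
Qed.

(** [G] is a function on faces with equal values on both sides of each edge. Turning at corners and
    stepping across edges links all darts of a connected component of the graph. *)
Lemma face_const_eq0 (G : dart -> rat) :
    (forall d, G (fn d) = G d) -> (forall p, G (p, true) = G (p, false)) ->
    (forall i : 'I_#|Roots|, G ((enum_val i, true), true) = 0) ->
  forall d, G d = 0.
Proof.
move=> Gn Gf G0.
have Gx x : G ((x, true), true) = G ((x, false), true).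
  by rewrite Gf -Gn.
have Gp p : G (p, true) = G (((nx p).1, true), true).
  case eqp: (nx p) => [x []] /=; last first.
    by have := Gn (p, true); rewrite /face_next eqp /= => ->.
  rewrite Gf -[p]nxK eqp Gx Gf; exact: (Gn ((x, false), false)).
have k0 := @const_on_comps_eq0 (fun x => G ((x, true), true)) _ G0.
have kE p : G (((nx p).1, true), true) = G ((p.1, true), true).
  rewrite -Gp; case: p => x []//=; by rewrite -Gx.
by case=> p []; rewrite -?Gf Gp k0.
Qed.

(** [A] and [B] are the coboundaries from crossings to edges and from edges to faces, acting on row
    vectors. With V crossings and C components of the graph, [A] has rank at least V - C. There are
    V + 2C faces, so [B] has rank at least V + C. Its kernel in dimension 2V then has dimension at
    most V - C, and the image of [A], contained in it, fills it. *)
Lemma planar_exact (c : branch D -> rat) : planar D ->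
    (forall phi : dart, \sum_(d | face d == phi) (if d.2 then c d.1 else - c d.1) = 0) ->
  exists h : crossing D -> rat, forall p, h (nx p).1 - h p.1 = c p.
Proof.
move=> /eqP planarD c_closed.
pose A := \matrix_(i < #|{: crossing D}|, j < #|{: branch D}|)
  ((enum_val i == (nx (enum_val j)).1)%:R - (enum_val i == (enum_val j).1)%:R) : 'M[rat]_(_, _).
pose B := \matrix_(i < #|{: branch D}|, j < #|Faces|)
  ((face (enum_val i, true) == enum_val j)%:R
   - (face (enum_val i, false) == enum_val j)%:R) : 'M[rat]_(_, _).
(* Evaluation at one crossing of each component, and below at one face of each component. Appending
   these columns makes the rows independent, which bounds the ranks from below. *)
pose RA := \matrix_(i < #|{: crossing D}|, j < #|Roots|) ((enum_val i == enum_val j)%:R : rat).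
pose RB := \matrix_(i < #|Faces|, j < #|Roots|)
  ((face ((enum_val j, true), true) == enum_val i)%:R : rat).
have vec (T : finType) (h : T -> rat) (x : T) :
    \sum_(i < #|{: T}|) h (enum_val i) * (enum_val i == x)%:R = h x.
  rewrite (bigD1 (enum_rank x)) //= enum_rankK eqxx mulr1 big1 ?addr0 // => i ni.
  by rewrite -(inj_eq enum_rank_inj) enum_valK (negPf ni) mulr0.
have rowA (h : crossing D -> rat) j :
    ((\row_i h (enum_val i)) *m A) 0 j = h (nx (enum_val j)).1 - h (enum_val j).1.
  rewrite !mxE; under eq_bigr do rewrite !mxE mulrBr.
  by rewrite sumrB !vec.
have rowB (k : branch D -> rat) j : ((\row_i k (enum_val i)) *m B) 0 j
    = \sum_(d | face d == enum_val j) (if d.2 then k d.1 else - k d.1).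
  rewrite !mxE.
  transitivity (\sum_p (k p * (face (p, true) == enum_val j)%:R
                        - k p * (face (p, false) == enum_val j)%:R)).
    rewrite [RHS](reindex (@enum_val {: branch D} predT)) /=; last exact: onW_bij (enum_val_bij _).
    by apply: eq_bigr => i _; rewrite !mxE mulrBr.
  transitivity (\sum_p \sum_(b : bool | face (p, b) == enum_val j) if b then k p else - k p).
    apply: eq_bigr => p _; rewrite big_mkcond big_bool /=.
    by do 2!case: eqP => _; rewrite ?mulr1 ?mulr0 ?subr0 ?sub0r ?addr0 ?add0r.
  by rewrite pair_big_dep /=; apply: eq_big => [[p b]|[p b] _].
have rowE (T : finType) (m : 'rV[rat]_#|T|) : m = \row_i (fun x => m 0 (enum_rank x)) (enum_val i).
  by apply/rowP=> i; rewrite !mxE enum_valK.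
have AB0 : A *m B = 0.
  apply/row_matrixP=> x; rewrite row0 row_mul.
  pose k (p : branch D) : rat := (enum_val x == (nx p).1)%:R - (enum_val x == p.1)%:R.
  have -> : row x A = \row_i k (enum_val i) by apply/rowP=> j; rewrite !mxE.
  apply/rowP=> j; rewrite rowB [RHS]mxE.
  (* A dart contributes through its two ends; at each corner the end of a dart and the beginning of
     the next are the same crossing, with opposite signs. *)
  pose tl (d : dart) : rat := - (enum_val x == edge_tail d)%:R.
  pose hd (d : dart) : rat := (enum_val x == edge_tail (fn d))%:R.
  apply: (@face_sum_eq0 _ hd tl (fun _ => 0)) => [[p []]|d]; last by rewrite /hd /tl !subrr.
    rewrite /k /tl /hd /edge_tail /face_next addrC /=.
    by case eqp: (nx p) => [y []] //=; rewrite pvK.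
  rewrite /k /tl /hd /edge_tail /face_next /= opprB addrC; congr (_ + _).
  by case: p => y [] //=; rewrite pvK.
have rankA : (#|{: crossing D}| <= \rank A + #|Roots|)%N.
  have /eqP : row_free (row_mx A RA).
    apply: inj_row_free => m; rewrite mul_mx_row => /eqP.
    rewrite row_mx_eq0 => /andP[/eqP mA /eqP mR]; rewrite (rowE _ m) in mA mR *.
    have k0 := @const_on_comps_eq0 (fun x => m 0 (enum_rank x)).
    apply/rowP=> i; rewrite !mxE k0 // => [p|j].
      have /rowP/(_ (enum_rank p)) := mA.
      by rewrite (rowA (fun x => m 0 (enum_rank x))) enum_rankK [RHS]mxE => /eqP; rewrite subr_eq0 => /eqP.
    have /rowP/(_ j) := mR; rewrite !mxE => e0; rewrite -[RHS]e0.
    rewrite -(vec _ (fun x => m 0 (enum_rank x)) (enum_val j)).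
    by apply: eq_bigr => l _; rewrite !mxE.
  move=> eqr; apply: (@leq_trans (\rank (row_mx A RA))); first by rewrite eqr.
  rewrite -mxrank_tr tr_row_mx -addsmxE.
  apply: leq_trans (mxrank_adds_leqif _ _) _; rewrite !mxrank_tr leq_add2l.
  exact: rank_leq_col.
have rankB : (#|Faces| <= \rank B + #|Roots|)%N.
  have /eqP : row_free (row_mx B^T RB).
    apply: inj_row_free => m; rewrite mul_mx_row => /eqP.
    rewrite row_mx_eq0 => /andP[/eqP mB /eqP mR].
    pose G d := \sum_j m 0 j * (face d == enum_val j)%:R.
    have G0 := @face_const_eq0 G; apply/rowP=> j; rewrite mxE.
    have : G (enum_val j) = 0.
      apply: G0 => [d|p|i]; first by rewrite /G; under eq_bigr do rewrite face_nextE.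
        apply/eqP; rewrite -subr_eq0 /G -sumrB; apply/eqP.
        have /rowP/(_ (enum_rank p)) := mB; rewrite !mxE => e0; rewrite -[RHS]e0.
        by apply: eq_bigr => l _; rewrite !mxE enum_rankK mulrBr.
      have /rowP/(_ i) := mR; rewrite !mxE => e0; rewrite -[RHS]e0.
      by apply: eq_bigr => l _; rewrite !mxE.
    have /andP[/eqP rj _] := enum_valP j.
    rewrite /G rj (bigD1 j) //= eqxx mulr1 big1 ?addr0 // => i ni.
    by rewrite (inj_eq enum_val_inj) eq_sym (negPf ni) mulr0.
  move=> eqr; apply: (@leq_trans (\rank (row_mx B^T RB))); first by rewrite eqr.
  rewrite -mxrank_tr tr_row_mx trmxK -addsmxE.
  apply: leq_trans (mxrank_adds_leqif _ _) _; rewrite mxrank_tr leq_add2l.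
  exact: rank_leq_col.
have ABker : (A <= kermx B)%MS by apply/sub_kermxP.
have : (kermx B <= A)%MS.
  rewrite -(mxrank_leqif_sup ABker) eqn_leq (mxrankS ABker) /= mxrank_ker.
  have eqF : #|Faces| = (#|{: crossing D}| + 2 * #|Roots|)%N := planarD.
  have eqE : #|{: branch D}| = (#|{: crossing D}| * 2)%N by rewrite card_prod card_bool.
  have count (e n k f a b : nat) : f = (n + 2 * k)%N -> e = (n * 2)%N ->
    (n <= a + k -> f <= b + k -> e - b <= a)%N by lia.
  exact: count eqF eqE rankA rankB.
have cB : (\row_i c (enum_val i)) *m B = 0.
  by apply/rowP=> j; rewrite rowB mxE c_closed.
move=> kerA; have /submxP[w cE] : (\row_i c (enum_val i) <= A)%MS.
  by apply: submx_trans kerA; apply/sub_kermxP.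
exists (fun x => w 0 (enum_rank x)) => p.
have /rowP/(_ (enum_rank p)) := cE.
by rewrite {1}(rowE _ w) (rowA (fun x => w 0 (enum_rank x))) mxE enum_rankK.
Qed.

Lemma alexander_numbering : planar D ->
  exists h : crossing D -> int, forall p,
    h (nx p).1 - h p.1 = (p.2 : nat)%:Z - (~~ (nx p).2 : nat)%:Z.
Proof.
(* Push the whole diagram off to its left.  [c] counts the signed crossings of
   the copy with an edge, [tl] and [hd] those near the ends of a dart, and [g]
   says whether the copy runs along the dart inside the face on its left. *)
pose c (p : branch D) : int := (p.2 : nat)%:Z - (~~ (nx p).2 : nat)%:Z.
move=> planarD; have [|h hP] := @planar_exact (fun p => (c p)%:~R) planarD.
  move=> phi.
  pose tl (d : dart) : rat := if d.2 then (d.1.2 : nat)%:R else (~~ (nx d.1).2 : nat)%:R.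
  pose hd (d : dart) : rat := if d.2 then - (~~ (nx d.1).2 : nat)%:R else - (d.1.2 : nat)%:R.
  pose g (d : dart) : rat := (d.2 : nat)%:R.
  apply: (@face_sum_eq0 _ hd tl g) => [[p []]|[p []]] /=.
  - by rewrite /tl /hd /= /c rmorphB.
  - by rewrite /tl /hd /= /c rmorphB /= opprB.
  - rewrite /tl /hd /g /face_next /=.
    by case eqp: (nx p) => [x []] //=; rewrite ?pvK ?oppr0 ?add0r ?subr0 ?subrr ?addNr.
  - rewrite /tl /hd /g /face_next /=.
    by case: p => x [] //=; rewrite ?pvK ?oppr0 ?addr0 ?sub0r ?subrr.
(* Linear algebra over the rationals gives a rational [h]; its differences along edges are integers,
   so rounding down preserves them. *)
exists (fun x => Num.floor (h x)) => p.
have -> : h (nx p).1 = h p.1 + (c p)%:~R by rewrite -hP addrC subrK.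
by rewrite floorDrz ?intr_int // intrKfloor addrAC subrr add0r.
Qed.

End Planar.

(** * The third Reidemeister move *)

(* The sides of a triangle, directed along its boundary, go from the branch
   [tl i] to the branch [hd i]; [G i] says that the strand follows this
   direction.  The values [A i] enter the triangle and [tri_out i] leave it.
   The first strand is over or flat; [s] says that the second strand is not
   under the third one. *)
Section TriangleValues.
Variables (F : fieldType) (s G1 G2 G3 : bool).
Variables (wt1 wh1 wt2 wh2 wt3 wh3 ot2 oh2 ot3 oh3 A1 A2 A3 : F).

Definition tri_mid1 := (if G1 then wt1 else wh1) * A1.
Definition tri_hd1 := if G1 then tri_mid1 else A1.
Definition tri_tl1 := if G1 then A1 else tri_mid1.

(** The value on the second side as long as it does not pass under the third strand; [tri_free3] is
    the analogue for the third side. Of these two strands, [s] tells which is computed first, and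
    the other one may use its value. *)
Definition tri_free2 := if G2 then wt2 * A2 + ot2 * tri_hd1 else wh2 * A2.
Definition tri_free3 := if G3 then wt3 * A3 else wh3 * A3 + oh3 * tri_tl1.

Definition tri_mid2 :=
  if s then tri_free2 else
  if G2 then tri_free2 else wh2 * A2 + oh2 * (if G3 then A3 else tri_free3).
Definition tri_mid3 :=
  if s then
    if G3 then wt3 * A3 + ot3 * (if G2 then tri_free2 else A2) else tri_free3
  else tri_free3.

Definition tri_out1 := (if G1 then wh1 else wt1) * tri_mid1.
Definition tri_out2 :=
  if G2 then wh2 * tri_mid2 + oh2 * (if G3 then A3 else tri_mid3)
  else wt2 * tri_mid2 + ot2 * tri_hd1.
Definition tri_out3 :=
  if G3 then wh3 * tri_mid3 + oh3 * tri_tl1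
  else wt3 * tri_mid3 + ot3 * (if G2 then tri_mid2 else A2).

End TriangleValues.

Section Triangle.
Variables (F : fieldType) (a b : crossing_kind -> bool -> F) (D : fvcode).
Variables (tl1 hd1 tl2 hd2 tl3 hd3 : branch D) (s G1 G2 G3 : bool).
Local Notation W z := (a (kind z.1) z.2).
Local Notation O z := (b (kind z.1) z.2).
Let first1 := if G1 then tl1 else hd1.
Let first2 := if G2 then tl2 else hd2.
Let first3 := if G3 then tl3 else hd3.
Let last1 := if G1 then hd1 else tl1.
Let last2 := if G2 then hd2 else tl2.
Let last3 := if G3 then hd3 else tl3.

(** The equations left once the three sides of the triangle are eliminated: the three edges leaving
    the triangle are expressed through the three entering it. *)
Definition triangle_row (y : branch D -> F) (z : branch D) : F :=
  let A1 := y (pv first1) in let A2 := y (pv first2) in let A3 := y (pv first3) in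
  if z == last1 then y z - tri_out1 G1 (W tl1) (W hd1) A1 else
  if z == last2 then y z - tri_out2 s G1 G2 G3 (W tl1) (W hd1) (W tl2) (W hd2)
                       (W tl3) (W hd3) (O tl2) (O hd2) (O tl3) (O hd3) A1 A2 A3 else
  if z == last3 then y z - tri_out3 s G1 G2 G3 (W tl1) (W hd1) (W tl2) (W hd2)
                       (W tl3) (W hd3) (O tl2) (O hd2) (O tl3) (O hd3) A1 A2 A3 else
  y z - W z * y (pv z) - O z * y (pv (other_branch z)).

Lemma triangle_fdet (S : finType) (psi : S -> branch D) :
    uniq [:: tl1; hd1; tl2; hd2; tl3; hd3] ->
    [/\ other_branch hd1 = tl2, other_branch hd2 = tl3 & other_branch hd3 = tl1] ->
    [/\ pv last1 = first1, pv last2 = first2 & pv last3 = first3] ->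
    O tl1 = 0 -> O hd1 = 0 -> (if s then O hd2 else O tl3) = 0 ->
    injective psi ->
    (forall z, (z \in codom psi) = (z \notin [:: first1; first2; first3])) ->
  fdet (@code_mx F a b D) =
    fdet (fun p q => triangle_row (fun z => (z == psi q)%:R) (psi p)).
Proof.
move=> U6 [o1 o2 o3] [pl1 pl2 pl3] Ot1 Oh1 Os psi_inj psiY.
have o1' : other_branch tl2 = hd1 by rewrite -o1 other_branchK.
have o2' : other_branch tl3 = hd2 by rewrite -o2 other_branchK.
have o3' : other_branch tl1 = hd3 by rewrite -o3 other_branchK.
pose Y := [:: first1; first2; first3].
have p6 : perm_eq (Y ++ [:: last1; last2; last3]) [:: tl1; hd1; tl2; hd2; tl3; hd3].
  apply/seq.permP => P; rewrite /Y /first1 /first2 /first3 /last1 /last2 /last3 /=.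
  by case: G1 G2 G3 => -[] [] /=; lia.
have U6' : uniq (Y ++ [:: last1; last2; last3]) by rewrite (perm_uniq p6).
have lastN z : z \in [:: last1; last2; last3] -> z \notin Y.
  by move: U6'; rewrite cat_uniq => /and3P[_ /hasPn h _] /h.
have pvY z : (pv z \in Y) = (z \in [:: last1; last2; last3]).
  by rewrite !inE -pl1 -pl2 -pl3 !(inj_eq (@pv_inj _)).
have firstN z : z \in Y -> pv z \notin Y.
  by move=> zY; rewrite pvY; apply: contraL zY => /lastN.
have /and3P[UY _ Ul] : [&& uniq Y, true & uniq [:: last1; last2; last3]].
  by move: U6'; rewrite cat_uniq => /and3P[-> _ ->].
have /and3P[f12 f13 f23] : [&& first2 != first1, first3 != first1 & first3 != first2].
  move: UY; rewrite /= !inE negb_or andbT -andbA => /and3P[h1 h2 h3].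
  by rewrite eq_sym h1 eq_sym h2 eq_sym h3.
have /and3P[l12 l13 l23] : [&& last2 != last1, last3 != last1 & last3 != last2].
  move: Ul; rewrite /= !inE negb_or andbT -andbA => /and3P[h1 h2 h3].
  by rewrite eq_sym h1 eq_sym h2 eq_sym h3.
pose A1 (y : branch D -> F) := y (pv first1).
pose A2 (y : branch D -> F) := y (pv first2).
pose A3 (y : branch D -> F) := y (pv first3).
pose m1 y := tri_mid1 G1 (W tl1) (W hd1) (A1 y).
pose m2 y := tri_mid2 s G1 G2 G3 (W tl1) (W hd1) (W tl2) (W hd2)
  (W tl3) (W hd3) (O tl2) (O hd2) (O hd3) (A1 y) (A2 y) (A3 y).
pose m3 y := tri_mid3 s G1 G2 G3 (W tl1) (W hd1) (W tl2) (W hd2)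
  (W tl3) (W hd3) (O tl2) (O tl3) (O hd3) (A1 y) (A2 y) (A3 y).
pose ext y z := if z == first1 then m1 y else if z == first2 then m2 y else
  if z == first3 then m3 y else y z.
have extN y z : z \notin Y -> ext y z = y z.
  by rewrite !inE !negb_or /ext => /and3P[/negPf-> /negPf-> /negPf->].
have ext1 y : ext y first1 = m1 y by rewrite /ext eqxx.
have ext2 y : ext y first2 = m2 y by rewrite /ext (negPf f12) eqxx.
have ext3 y : ext y first3 = m3 y by rewrite /ext (negPf f13) (negPf f23) eqxx.
have eA1 y : ext y (pv first1) = A1 y by rewrite extN // firstN // !inE eqxx.
have eA2 y : ext y (pv first2) = A2 y by rewrite extN // firstN // !inE eqxx orbT.
have eA3 y : ext y (pv first3) = A3 y by rewrite extN // firstN // !inE eqxx !orbT.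
have eh1 y : ext y (pv hd1) = tri_hd1 G1 (W tl1) (W hd1) (A1 y).
  rewrite -[_ G1 _ _ _]/(if G1 then m1 y else A1 y).
  have := eA1 y; have := ext1 y; have := pl1; rewrite /first1 /last1.
  by case: (G1) => e1 e2 e3; rewrite ?e1 ?e2 ?e3.
have et1 y : ext y (pv tl1) = tri_tl1 G1 (W tl1) (W hd1) (A1 y).
  rewrite -[_ G1 _ _ _]/(if G1 then A1 y else m1 y).
  have := eA1 y; have := ext1 y; have := pl1; rewrite /first1 /last1.
  by case: (G1) => e1 e2 e3; rewrite ?e1 ?e2 ?e3.
have eh2 y : ext y (pv hd2) = if G2 then m2 y else A2 y.
  have := eA2 y; have := ext2 y; have := pl2; rewrite /first2 /last2.
  by case: (G2) => e1 e2 e3; rewrite ?e1 ?e2 ?e3.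
have et3 y : ext y (pv tl3) = if G3 then A3 y else m3 y.
  have := eA3 y; have := ext3 y; have := pl3; rewrite /first3 /last3.
  by case: (G3) => e1 e2 e3; rewrite ?e1 ?e2 ?e3.
(* The first strand is never under, so its side has lowest rank; then comes whichever of the two
   others is not under the remaining one. *)
pose r z : nat := if z == first1 then 0%N else if z == first2 then (~~ s).+1 else s.+1.
rewrite (@fdet_elim F S _ (@code_mx F a b D) psi
  (fun z q => ext (fun z => (z == psi q)%:R) z) r _ psi_inj _ _ (fun p q => erefl)).
- rewrite big1 => [|z]; last first.
    rewrite psiY negbK => zY; apply: code_mx_diag.
      by apply: contraTneq (firstN _ zY) => ->; rewrite zY.
    apply/eqP => eqz; move: zY; rewrite !inE => /or3P[] /eqP zE.
    + have /pv_inj : pv (other_branch z) = pv last1 by rewrite eqz pl1.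
      rewrite zE /first1 /last1; case: (G1) => eqo.
        by move: U6; rewrite -o3' eqo /= !inE eqxx ?orbT ?andbF.
      by move: U6; rewrite -o1 eqo /= !inE eqxx ?orbT ?andbF.
    + have /pv_inj : pv (other_branch z) = pv last2 by rewrite eqz pl2.
      rewrite zE /first2 /last2; case: (G2) => eqo.
        by move: U6; rewrite -o1' eqo /= !inE eqxx ?orbT ?andbF.
      by move: U6; rewrite -o2 eqo /= !inE eqxx ?orbT ?andbF.
    + have /pv_inj : pv (other_branch z) = pv last3 by rewrite eqz pl3.
      rewrite zE /first3 /last3; case: (G3) => eqo.
        by move: U6; rewrite -o2' eqo /= !inE eqxx ?orbT ?andbF.
      by move: U6; rewrite -o3 eqo /= !inE eqxx ?orbT ?andbF.
  rewrite mul1r; apply: eq_fdet => p q; pose y := (fun z => (z == psi q)%:R) : branch D -> F.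
  rewrite sum_code_mx -/y.
  have pY : psi p \notin Y by rewrite -psiY codom_f.
  rewrite (extN _ _ pY) /triangle_row -/y -/(A1 y) -/(A2 y) -/(A3 y).
  have [->|n1] := eqVneq (psi p) last1.
    rewrite pl1 ext1 /tri_out1 -/(m1 y) /last1.
    by case: (G1); rewrite ?Ot1 ?Oh1 mul0r subr0.
  have [->|n2] := eqVneq (psi p) last2.
    rewrite pl2 ext2 /tri_out2 -/(m2 y) -/(m3 y) -addrA -opprD /last2.
    by case: (G2); rewrite ?o2 ?o1' ?et3 ?eh1.
  have [->|n3] := eqVneq (psi p) last3.
    rewrite pl3 ext3 /tri_out3 -/(m2 y) -/(m3 y) -addrA -opprD /last3.
    by case: (G3); rewrite ?o3 ?o2' ?et1 ?eh2.
  have nl z : z \notin [:: last1; last2; last3] -> ext y (pv z) = y (pv z).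
    by move=> nz; rewrite extN // pvY.
  rewrite nl ?inE ?negb_or ?n1 ?n2 ?n3 // nl //.
  (* The six branches are closed under [other_branch], so an equation away from the corners does not
     see the sides of the triangle. *)
  have n6 : psi p \notin [:: tl1; hd1; tl2; hd2; tl3; hd3].
    by rewrite -(perm_mem p6) mem_cat negb_or pY !inE !negb_or n1 n2 n3.
  apply: contra n6 => ol; rewrite -[psi p]other_branchK.
  have : other_branch (psi p) \in Y ++ [:: last1; last2; last3] by rewrite mem_cat ol orbT.
  rewrite (perm_mem p6) !inE => /or4P[||| /or3P[]] /eqP->;
    by rewrite ?o1 ?o2 ?o3 ?o1' ?o2' ?o3' eqxx ?orbT.
- by move=> p q; rewrite extN -?psiY ?codom_f // (inj_eq psi_inj).
- move=> z q; rewrite psiY negbK sum_code_mx !inE.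
  set y := (fun z => (z == psi q)%:R) : branch D -> F.
  case/or3P => /eqP->.
  + rewrite ext1 eA1 /m1 /tri_mid1 /first1.
    by case: (G1); rewrite ?Ot1 ?Oh1 mul0r subr0 subrr.
  + rewrite ext2 eA2 -addrA -opprD /first2; apply/eqP; rewrite subr_eq0; apply/eqP.
    rewrite /m2 /tri_mid2 /tri_free2.
    have := et3 y; have := eh1 y; rewrite /m3 /tri_mid3 => h1 h3.
    move: Os h1 h3; case: (s); case: (G2) => O0 h1 h3;
      by rewrite ?o2 ?o1' ?h1 ?h3 ?O0 ?mul0r ?addr0.
  + rewrite ext3 eA3 -addrA -opprD /first3; apply/eqP; rewrite subr_eq0; apply/eqP.
    rewrite /m3 /tri_mid3 /tri_free3.
    have := et1 y; have := eh2 y; rewrite /m2 /tri_mid2 => h2 h1.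
    move: Os h1 h2; case: (s); case: (G3) => O0 h1 h2;
      by rewrite ?o3 ?o2' ?h1 ?h2 ?O0 ?mul0r ?addr0.
- move=> z z'; rewrite !psiY !negbK => zY z'Y ne /(code_mx_neq0 ne)[eqz'|].
    by have := firstN _ zY; rewrite -eqz' z'Y.
  case=> Oz eqz'; move: z'Y; rewrite eqz' pvY => ol.
  have [Y1 Y2 Y3] : [/\ first1 \in Y, first2 \in Y & first3 \in Y].
    by rewrite !inE !eqxx ?orbT.
  have r1 : r first1 = 0%N by rewrite /r eqxx.
  have r2 : r first2 = (~~ s).+1 by rewrite /r (negPf f12) eqxx.
  have r3 : r first3 = s.+1 by rewrite /r (negPf f13) (negPf f23).
  have r1h : hd1 \in [:: last1; last2; last3] -> r (pv hd1) = 0%N.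
    move=> /lastN hN; move: pl1 Y1 r1; rewrite /first1 /last1.
    by case: (G1) => [->//|_ h1Y]; rewrite h1Y in hN.
  have r1t : tl1 \in [:: last1; last2; last3] -> r (pv tl1) = 0%N.
    move=> /lastN hN; move: pl1 Y1 r1; rewrite /first1 /last1.
    by case: (G1) => [_ h1Y|->//]; rewrite h1Y in hN.
  have r2h : hd2 \in [:: last1; last2; last3] -> r (pv hd2) = (~~ s).+1.
    move=> /lastN hN; move: pl2 Y2 r2; rewrite /first2 /last2.
    by case: (G2) => [->//|_ h1Y]; rewrite h1Y in hN.
  have r3t : tl3 \in [:: last1; last2; last3] -> r (pv tl3) = s.+1.
    move=> /lastN hN; move: pl3 Y3 r3; rewrite /first3 /last3.
    by case: (G3) => [_ h1Y|->//]; rewrite h1Y in hN.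
  have := zY; rewrite !inE => /or3P[] /eqP zE; move: Oz ol; rewrite zE.
  - by rewrite /first1; case: (G1); rewrite ?Ot1 ?Oh1 eqxx.
  - rewrite r2 /first2; case: (G2); first by rewrite o1' => _ /r1h->.
    move: Os; rewrite o2; case: (s) r3t => [_ ->|r3t _ _ /r3t->//]; first by rewrite eqxx.
  - rewrite r3 /first3; case: (G3); last by rewrite o3 => _ /r1t->.
    by move: Os; rewrite o2'; case: (s) r2h => [r2h _ _ /r2h->|_ ->] //; rewrite eqxx.
Qed.

End Triangle.

Section TriangleMove.
Variables (F : fieldType) (t u v : F).
Hypotheses (t0 : t != 0) (u0 : u != 0) (v0 : v != 0).
Local Notation W := (along_wt t u v).
Local Notation O := (over_wt t).

(* The move exchanges the two corners on each strand: the crossings keep their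
   branches, but every strand now runs through its side the other way round. *)
Lemma tri_out_flip (F1 F2 F3 oC : bool) kA kB kC s (A1 A2 A3 : F) :
    [\/ [/\ kA = Classical (~~ (F3 (+) F1)), kB = Classical (F1 (+) F2) & kC = Classical oC],
        [/\ kA = Flat, kB = Flat & kC = Flat]
      | [/\ kA = Flat, kB = Flat & kC = Classical oC]] ->
    s = (oC == (F2 (+) F3)) ->
  let wt1 := W kA (~~ (F3 (+) F1)) in let wh3 := W kA (F3 (+) F1) in
  let wh1 := W kB (F1 (+) F2) in let wt2 := W kB (~~ (F1 (+) F2)) in
  let wh2 := W kC (F2 (+) F3) in let wt3 := W kC (~~ (F2 (+) F3)) in
  let ot2 := O kB (~~ (F1 (+) F2)) in let oh2 := O kC (F2 (+) F3) in
  let ot3 := O kC (~~ (F2 (+) F3)) in let oh3 := O kA (F3 (+) F1) in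
  [/\ tri_out1 F1 wt1 wh1 A1 = tri_out1 (~~ F1) wt1 wh1 A1,
      tri_out2 s F1 F2 F3 wt1 wh1 wt2 wh2 wt3 wh3 ot2 oh2 ot3 oh3 A1 A2 A3
      = tri_out2 s (~~ F1) (~~ F2) (~~ F3)
          wt1 wh1 wt2 wh2 wt3 wh3 ot2 oh2 ot3 oh3 A1 A2 A3
    & tri_out3 s F1 F2 F3 wt1 wh1 wt2 wh2 wt3 wh3 ot2 oh2 ot3 oh3 A1 A2 A3
      = tri_out3 s (~~ F1) (~~ F2) (~~ F3)
          wt1 wh1 wt2 wh2 wt3 wh3 ot2 oh2 ot3 oh3 A1 A2 A3].
Proof.
move=> kP ->; rewrite /tri_out2 /tri_out3 /tri_mid2 /tri_mid3 /tri_free2 /tri_free3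
  /tri_hd1 /tri_tl1 /tri_out1 /tri_mid1.
(* For each type of move, sixteen choices of directions and of the over branch at the third corner;
   each leaves identities between rational functions of [t] and [u]. *)
case: kP => -[-> -> ->]; clear kA kB kC;
  case: F1; case: F2; case: F3; case: oC; rewrite /= /under_wt;
  split; (reflexivity || (by field; rewrite ?t0 ?u0)).
Qed.

End TriangleMove.

Definition dart_tl (D : fvcode) (d : branch D * bool) := if d.2 then d.1 else nx d.1.
Definition dart_hd (D : fvcode) (d : branch D * bool) := if d.2 then nx d.1 else d.1.

(** By the frame convention, a left turn arrives on branch [true] exactly when the face boundary
    follows one of the two strands forwards and the other backwards. All six branches of a triangle
    are thus determined by three directions. *)
Lemma face_next_corner (D : fvcode) (d d' : branch D * bool) : face_next d = d' ->
  other_branch (dart_hd d) = dart_tl d' /\ (dart_hd d).2 = d.2 (+) d'.2.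
Proof.
move=> <-; case: d => p []; rewrite /face_next /dart_hd /dart_tl /=.
  by case eqp: (nx p) => [x []] //=; rewrite pvK.
by case: p => x [] //=; rewrite pvK.
Qed.

Section Reidemeister3.
Variables (F : fieldType) (t u v : F).
Hypotheses (t0 : t != 0) (u0 : u != 0) (v0 : v != 0).
Local Notation W := (along_wt t u v).
Local Notation O := (over_wt t).

(** The map [phi] commutes with [pv], but at the corners of the triangle not with [other_branch].
    Eliminating the three sides in both diagrams leaves systems on the same index set; their rows
    agree at the exits of the triangle by [tri_out_flip], and elsewhere because [sg] fixes the
    branches involved. *)
Lemma reidemeister3_code_det D D' : reidemeister3 D D' ->
  code_det W O D' = code_det W O D.
Proof.
case=> f [d1 [d2 [d3]]] /=.
set p1 := d1.1; set p2 := d2.1; set p3 := d3.1.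
pose sg q := tperm p1 (nx p1) (tperm p2 (nx p2) (tperm p3 (nx p3) q)).
move=> [[fn1 fn2 fn3] Utl kP [f_bij fk] eqD].
pose lf := lift_branch f; pose phi q := lf (sg q).
have lf_bij : bijective lf.
  by case: f_bij => g fK gK; exists (lift_branch g) => -[x c]; rewrite /lf /lift_branch /= ?fK ?gK.
have lf_inj := bij_inj lf_bij.
have sg_inj : injective sg by move=> x y /perm_inj/perm_inj/perm_inj.
have phi_inj : injective phi by move=> x y /lf_inj/sg_inj.
have phi_bij : bijective phi.
  by apply: bij_comp lf_bij _; apply: injF_bij.
have eqD' : perm_eq (comps D') [seq rot ((fun=> 0%N) w) (map phi w) | w <- comps D].
  rewrite eqD; under [X in perm_eq _ X]eq_map do rewrite rot0.
  by [].
have pvphi := pv_morph phi_inj eqD'.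
rewrite /code_det (nil_comps_morph eqD'); case: ifP => // _.
have [h1 b1] := face_next_corner fn1.
have [h2 b2] := face_next_corner fn2.
have [h3 b3] := face_next_corner fn3.
set tl1 := dart_tl d1 in h3 *; set hd1 := dart_hd d1 in h1 b1 *.
set tl2 := dart_tl d2 in h1 *; set hd2 := dart_hd d2 in h2 b2 *.
set tl3 := dart_tl d3 in h2 *; set hd3 := dart_hd d3 in h3 b3 *.
have tlE d : edge_tail d = (dart_tl d).1 by rewrite /edge_tail /dart_tl; case: ifP.
move: Utl kP; rewrite !tlE -/tl1 -/tl2 -/tl3 => Utl kP.
have U6 : uniq [:: tl1; hd1; tl2; hd2; tl3; hd3].
  move: Utl; rewrite -h1 -h2 -h3 /=; case: (hd1) (hd2) (hd3) => [x1 e1] [x2 e2] [x3 e3].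
  rewrite /other_branch /= !inE !xpair_eqE !negb_or => /and3P[/andP[n31 n32] n12 _].
  have [/negPf m31 /negPf m32 /negPf m12] := And3 n31 n32 n12.
  have [m13 m23 m21] : [/\ (x1 == x3) = false, (x2 == x3) = false & (x2 == x1) = false].
    by rewrite ![_ == x3]eq_sym [x2 == x1]eq_sym.
  rewrite !(m31, m32, m12, m13, m23, m21) !eqxx /= !andbT.
  by case: (e1) (e2) (e3) => -[] [].
have tl1E : tl1.2 = ~~ (d3.2 (+) d1.2) by rewrite -h3 /= b3.
have tl2E : tl2.2 = ~~ (d1.2 (+) d2.2) by rewrite -h1 /= b1.
have tl3E : tl3.2 = ~~ (d2.2 (+) d3.2) by rewrite -h2 /= b2.
have [x3 x1 x2] : [/\ hd3.1 = tl1.1, hd1.1 = tl2.1 & hd2.1 = tl3.1] by rewrite -h1 -h2 -h3.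
(* When this corner is flat, the default is harmless: both over coefficients vanish there, and
   either value of [s] is admissible. *)
pose oC := if kind tl3.1 is Classical o then o else true.
pose s := oC == (d2.2 (+) d3.2).
have kP' : [\/ [/\ kind tl1.1 = Classical (~~ (d3.2 (+) d1.2)),
                  kind tl2.1 = Classical (d1.2 (+) d2.2) & kind tl3.1 = Classical oC],
              [/\ kind tl1.1 = Flat, kind tl2.1 = Flat & kind tl3.1 = Flat]
            | [/\ kind tl1.1 = Flat, kind tl2.1 = Flat & kind tl3.1 = Classical oC]].
  have kC : is_classical (kind tl3.1) -> kind tl3.1 = Classical oC.
    by rewrite /oC; case: (kind tl3.1).
  have kF (x : crossing D) : is_flat x -> kind x = Flat by rewrite /is_flat; case: (kind x).
  have kO z : is_over z -> kind z.1 = Classical z.2.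
    by rewrite /is_over; case: (kind z.1) => // o /eqP->.
  have both (P : branch D -> Prop) : P p1 -> P (nx p1) -> P tl1 /\ P hd1.
    by rewrite /tl1 /hd1 /dart_tl /dart_hd; case: ifP.
  case: kP => -[k1 k2 k3].
  - have [/kO kt /kO kh] := both (fun z => is_over z) k1 k2.
    by constructor 1; split; rewrite -?x1 ?kt ?kh ?tl1E ?b1 // kC.
  - have [/kF kt /kF kh] := both (fun z => is_flat z.1) k1 k2.
    by constructor 2; split; rewrite -?x1 // kF.
  - have [/kF kt /kF kh] := both (fun z => is_flat z.1) k1 k2.
    by constructor 3; split; rewrite -?x1 // kC.
have flip A1 A2 A3 := @tri_out_flip F t u v t0 u0 _ _ _ _ _ _ _ s A1 A2 A3 kP' erefl.
have Ot1 : O (kind tl1.1) tl1.2 = 0.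
  by rewrite tl1E; case: kP' => -[-> _ _] //=; rewrite eqxx.
have Oh1 : O (kind hd1.1) hd1.2 = 0.
  by rewrite x1 b1; case: kP' => -[_ -> _] //=; rewrite eqxx.
have Os : (if s then O (kind hd2.1) hd2.2 else O (kind tl3.1) tl3.2) = 0.
  rewrite x2 b2 tl3E /s; case: kP' => -[_ _ ->] /=; case: ifP => // h.
  - by rewrite eq_sym h.
  - by move: h; case: (oC); case: (d2.2); case: (d3.2).
  - by rewrite eq_sym h.
  - by move: h; case: (oC); case: (d2.2); case: (d3.2).
have fl d : (if d.2 then dart_tl d else dart_hd d) = d.1 :> branch D.
  by case: d => z [].
have ll d : (if d.2 then dart_hd d else dart_tl d) = nx d.1 :> branch D.
  by case: d => z [].
have ifN (X : Type) (c : bool) (x y : X) : (if ~~ c then x else y) = if c then y else x.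
  by case: c.
have iflf (c : bool) x y : (if c then lf x else lf y) = lf (if c then x else y) by case: c.
pose S : finType := {z : branch D | z \notin [:: p1; p2; p3]}.
pose psi (z : S) : branch D := val z.
have psiY z : (z \in codom psi) = (z \notin [:: p1; p2; p3]).
  apply/codomP/idP => [[w ->]|zY]; first exact: (valP w).
  by exists (Sub z zY); rewrite /psi SubK.
have p6 : perm_eq [:: p1; nx p1; p2; nx p2; p3; nx p3] [:: tl1; hd1; tl2; hd2; tl3; hd3].
  have side (d : branch D * bool) : perm_eq [:: d.1; nx d.1] [:: dart_tl d; dart_hd d].
    by case: d => z [] //; rewrite -(perm_rot 1).
  exact: (perm_cat (side d1) (perm_cat (side d2) (side d3))).
have := U6; rewrite -(perm_uniq p6) /= !inE !negb_or -!andbA => /and5P[n1 n2 n3 n4 /and5P[n5 n6 n7 n8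
  /and5P[n9 n10 n11 n12 /and4P[n13 n14 n15 _]]]].
have [sgp1 sgp2 sgp3] : [/\ sg p1 = nx p1, sg p2 = nx p2 & sg p3 = nx p3].
  rewrite /sg; split.
  - by rewrite (@tpermD _ p3 (nx p3) p1) ?(@tpermD _ p2 (nx p2) p1) ?tpermL // eq_sym.
  - by rewrite (@tpermD _ p3 (nx p3) p2) ?tpermL ?tpermD // eq_sym.
  - by rewrite tpermL (@tpermD _ p2 (nx p2)) ?tpermD // eq_sym.
have [sgq1 sgq2 sgq3] : [/\ sg (nx p1) = p1, sg (nx p2) = p2 & sg (nx p3) = p3].
  rewrite /sg; split.
  - by rewrite (@tpermD _ p3 (nx p3) (nx p1)) ?(@tpermD _ p2 (nx p2) (nx p1)) ?tpermR // eq_sym.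
  - by rewrite (@tpermD _ p3 (nx p3) (nx p2)) ?tpermR ?tpermD // eq_sym.
  - by rewrite tpermR (@tpermD _ p2 (nx p2)) ?tpermD // eq_sym.
have sgN z : z \notin [:: tl1; hd1; tl2; hd2; tl3; hd3] -> sg z = z.
  rewrite -(perm_mem p6) !inE !negb_or -?andbA => /and5P[m1 m2 m3 m4 /andP[m5 m6]].
  by rewrite /sg !tpermD // eq_sym.
have otherN z : z \notin [:: tl1; hd1; tl2; hd2; tl3; hd3] ->
    other_branch z \notin [:: tl1; hd1; tl2; hd2; tl3; hd3].
  apply: contra => zo; rewrite -[z]other_branchK; move: zo.
  have [o1 o2 o3] : [/\ other_branch tl2 = hd1, other_branch tl3 = hd2 & other_branch tl1 = hd3].
    by rewrite -h1 -h2 -h3 !other_branchK.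
  rewrite !inE => /or4P[||| /or3P[]] /eqP->;
    by rewrite ?o1 ?o2 ?o3 ?h1 ?h2 ?h3 eqxx ?orbT.
have pvD : [/\ pv (if d1.2 then hd1 else tl1) = (if d1.2 then tl1 else hd1),
    pv (if d2.2 then hd2 else tl2) = (if d2.2 then tl2 else hd2)
  & pv (if d3.2 then hd3 else tl3) = (if d3.2 then tl3 else hd3)].
  by rewrite !ll !fl !nxK.
have psiY' z : (z \in codom psi) = (z \notin [:: if d1.2 then tl1 else hd1;
    if d2.2 then tl2 else hd2; if d3.2 then tl3 else hd3]) by rewrite psiY !fl.
rewrite (@triangle_fdet F W O D _ _ _ _ _ _ s _ _ _ S psi U6 (And3 h1 h2 h3) pvD Ot1 Oh1 Os (val_inj : injective psi) psiY').
have phip : [/\ phi p1 = lf (nx p1), phi p2 = lf (nx p2) & phi p3 = lf (nx p3)].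
  by rewrite /phi sgp1 sgp2 sgp3.
have phiq : [/\ phi (nx p1) = lf p1, phi (nx p2) = lf p2 & phi (nx p3) = lf p3].
  by rewrite /phi sgq1 sgq2 sgq3.
case: phip => phip1 phip2 phip3; case: phiq => phiq1 phiq2 phiq3.
(* In [D'] each strand meets its two corners in the opposite order, hence the negated directions. *)
have pvD' : [/\ pv (if ~~ d1.2 then lf hd1 else lf tl1) = (if ~~ d1.2 then lf tl1 else lf hd1),
    pv (if ~~ d2.2 then lf hd2 else lf tl2) = (if ~~ d2.2 then lf tl2 else lf hd2)
  & pv (if ~~ d3.2 then lf hd3 else lf tl3) = (if ~~ d3.2 then lf tl3 else lf hd3)].
  by rewrite !ifN !iflf !ll !fl -phip1 -phip2 -phip3 -phiq1 -phiq2 -phiq3 !pvphi !nxK.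
have hD' : [/\ other_branch (lf hd1) = lf tl2, other_branch (lf hd2) = lf tl3
    & other_branch (lf hd3) = lf tl1] by rewrite -h1 -h2 -h3.
have psiY2 z : (z \in codom (phi \o psi)) = (z \notin [:: if ~~ d1.2 then lf tl1 else lf hd1;
    if ~~ d2.2 then lf tl2 else lf hd2; if ~~ d3.2 then lf tl3 else lf hd3]).
  case: phi_bij => phi' phiK phi'K; rewrite -(phi'K z) !ifN !iflf !ll -phip1 -phip2 -phip3.
  rewrite (mem_map phi_inj [:: p1; p2; p3]) -psiY.
  by apply/codomP/codomP => -[w] => [/phi_inj|] => ->; exists w.
have U6' : uniq [:: lf tl1; lf hd1; lf tl2; lf hd2; lf tl3; lf hd3].
  by rewrite (map_inj_uniq lf_inj [:: tl1; _; _; _; _; _]).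
have Ot1' : O (kind (lf tl1).1) (lf tl1).2 = 0 by rewrite /= fk.
have Oh1' : O (kind (lf hd1).1) (lf hd1).2 = 0 by rewrite /= fk.
have Os' : (if s then O (kind (lf hd2).1) (lf hd2).2 else O (kind (lf tl3).1) (lf tl3).2) = 0.
  by rewrite /= !fk.
have psi_inj' : injective (phi \o psi) by apply: inj_comp phi_inj _; apply: val_inj.
rewrite (@triangle_fdet F W O D' _ _ _ _ _ _ s _ _ _ S (phi \o psi) U6' hD' pvD' Ot1' Oh1' Os' psi_inj' psiY2).
apply: eq_fdet => p q; rewrite /triangle_row /comp.
rewrite !ifN !iflf !fl !ll -phip1 -phip2 -phip3 -phiq1 -phiq2 -phiq3.
rewrite !pvphi !(inj_eq phi_inj) -/(psi p) -/(psi q).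
have [flip1 flip2 flip3] := flip (pv p1 == psi q)%:R (pv p2 == psi q)%:R (pv p3 == psi q)%:R.
have kf z : kind (lf z).1 = kind z.1 by rewrite /= fk.
rewrite !kf !(_ : forall z, (lf z).2 = z.2) //.
rewrite x1 x2 x3 tl1E tl2E tl3E b1 b2 b3.
case: eqP => [_|m1]; first by rewrite flip1.
case: eqP => [_|m2]; first by rewrite flip2.
case: eqP => [_|m3]; first by rewrite flip3.
have z6 : psi p \notin [:: tl1; hd1; tl2; hd2; tl3; hd3].
  rewrite -(perm_mem p6) !inE !negb_or; have := valP p; rewrite !inE !negb_or.
  case/and3P=> -> -> ->; do !(apply/andP; split) => //; exact/eqP.
have -> : other_branch (phi (psi p)) = phi (other_branch (psi p)).
  by rewrite /phi !sgN ?otherN.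
rewrite pvphi !(inj_eq phi_inj).
by rewrite /phi sgN // kf.
Qed.

End Reidemeister3.

(** * Long arcs *)

Lemma nth_traject_default (T : Type) (f : T -> T) (x0 x : T) n i :
  (i < n)%N -> nth x0 (traject f x n) i = iter i f x.
Proof.
by move=> lt_in; rewrite (set_nth_default x) ?size_traject // nth_traject.
Qed.

Section LongArcs.
Variable D : fvcode.
Hypothesis has_under : every_comp_has_underpass D.
Local Notation under := (@is_under D).
Local Notation depth := (kept_depth (@pv D) under).
Local Notation root := (kept_root (@pv D) under).
Implicit Types (z p : branch D) (x : crossing D).

Lemma under_reach z : exists k, under (iter k (@pv D) z).
Proof.
have [w wD zw] := mem_comps z; have /hasP[p pw up] := allP has_under _ wD.
by exists (findex (@pv D) z p); rewrite iter_findex //; apply: fconnect_pv wD zw pw.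
Qed.

Lemma iter_nxK k z : iter k (@pv D) (iter k (@nx D) z) = z.
Proof. by elim: k => //= k IHk; rewrite -iterS iterSr nxK. Qed.

Lemma iter_pvK k z : iter k (@nx D) (iter k (@pv D) z) = z.
Proof. by elim: k => //= k IHk; rewrite -iterS iterSr pvK. Qed.

Lemma iter_pv_nx i j z : (i <= j)%N ->
  iter i (@pv D) (iter j (@nx D) z) = iter (j - i) (@nx D) z.
Proof. by move=> le_ij; rewrite -{1}(subnKC le_ij) iterD iter_nxK. Qed.

(** The list contains the branches at which the edges of the arc arrive, while edges are named by
    their starting branch. This shifts indices by one: the edge arriving at the first entry is the
    underpass itself, at depth 0. *)
Lemma long_arc_nth x z j : is_classical (kind x) ->
  j = index z (long_arc x) -> z \in long_arc x ->
  z = iter j.+1 (@nx D) (under_branch x) /\ depth (pv z) = j.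
Proof.
move=> cx jE zx; have ux : under (under_branch x).
  by rewrite /is_under /=; case: (kind x) cx => // o _ /=; case: o.
have jlt : (j < size (long_arc x))%N by rewrite jE index_mem.
have zj : nth z (long_arc x) j = z by rewrite jE nth_index.
move: jlt zj; rewrite /long_arc; set ps := traject _ _ _.
rewrite size_take_min leq_min => /andP[jf jN]; rewrite nth_take //.
have nthps i : (i < size ps)%N -> nth z ps i = iter i.+1 (@nx D) (under_branch x).
  by rewrite size_traject => ltiN; rewrite /ps nth_traject_default // -iterSr.
rewrite nthps // => zE; split => //.
have pvzE : pv z = iter j (@nx D) (under_branch x) by rewrite -zE /= nxK.
apply: kept_depthP => [||i ltij]; first exact: under_reach.
  by rewrite pvzE iter_nxK.
rewrite pvzE iter_pv_nx 1?ltnW // -(prednK (_ : 0 < j - i)%N) ?subn_gt0 //.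
have ltjf : ((j - i).-1 < find under ps)%N by apply: leq_trans (jf : (j <= _)%N); lia.
rewrite -nthps ?before_find //.
by apply: leq_ltn_trans jN; lia.
Qed.

Lemma mem_long_arc x z : is_classical (kind x) ->
  (z \in long_arc x) = (root (pv z) == under_branch x).
Proof.
move=> cx; apply/idP/eqP=> [zx|rootE].
  have [zE dE] := long_arc_nth cx erefl zx.
  have pzE : pv z = iter (index z (long_arc x)) (@nx D) (under_branch x).
    by rewrite {1}zE /= nxK.
  by rewrite /kept_root dE pzE iter_nxK.
pose d := depth (pv z).
(* The trajectory in [long_arc] is cut at the number of branches, which is long enough to reach
   [z]. *)
have ltdN : (d < #|{: branch D}|)%N.
  by apply: leq_trans (kept_depth_order under_reach _) (max_card _).
have zE : z = iter d (@nx D) (nx (under_branch x)).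
  by rewrite -iterSr -rootE /kept_root /= iter_pvK pvK.
have pzE : pv z = iter d (@nx D) (under_branch x) by rewrite {1}zE -iterSr iterS nxK.
rewrite /long_arc; set ps := traject _ _ _.
have sz_ps : size ps = #|{: branch D}| by rewrite size_traject.
have dps : nth z ps d = z by rewrite /ps nth_traject_default // -zE.
(* An underpass met earlier on the arc would be met first when walking back from [z]. *)
have le_df : (d <= find under ps)%N.
  rewrite leqNgt; apply/negP=> ltfd.
  have hu : has under ps by rewrite has_find (leq_trans ltfd) // sz_ps ltnW.
  have := nth_find z hu; rewrite -/ps {1}/ps nth_traject_default; last by rewrite -sz_ps -has_find.
  set j := find _ _ in ltfd *; rewrite -iterSr.
  have -> : iter j.+1 (@nx D) (under_branch x) = iter (d - j.+1) (@pv D) (pv z).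
    by rewrite pzE iter_pv_nx ?leq_subr // subKn.
  by rewrite (keep_before under_reach) // -/d; lia.
rewrite -{1}dps -(@nth_take (find under ps).+1) ?ltnS //.
by rewrite mem_nth // size_take_min leq_min ltnS le_df sz_ps.
Qed.

(** Label of the short arc leaving [z], computed backwards. The underpass where the walk stops is
    excluded, so the initial short arc has label 1. *)
Definition arc_label z : Rtvu :=
  \prod_(i < depth z) label_factor (iter i (@pv D) z).

Lemma arc_label0 z : under z -> arc_label z = 1.
Proof. by move=> uz; rewrite /arc_label kept_depth0 ?big_ord0 //; apply: under_reach. Qed.

Lemma arc_labelS z : ~~ under z -> arc_label z = label_factor z * arc_label (pv z).
Proof.
move=> uz; rewrite /arc_label kept_depthS //; last exact: under_reach.
by rewrite big_ord_recl; congr (_ * _); apply: eq_bigr => i _; rewrite -iterSr.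
Qed.

Lemma labelE x z : is_classical (kind x) -> z \in long_arc x ->
  label x z = arc_label (pv z).
Proof.
move=> cx zx; have [zE dE] := long_arc_nth cx erefl zx.
have pzE : pv z = iter (index z (long_arc x)) (@nx D) (under_branch x).
  by rewrite {1}zE /= nxK.
rewrite /label /arc_label dE.
have ltj : (index z (long_arc x) < size (long_arc x))%N by rewrite index_mem.
rewrite (big_nth z) size_take ltj big_mkord (reindex_inj rev_ord_inj) /=.
apply: eq_bigr => i _; congr label_factor.
have lt_i : (i < index z (long_arc x))%N := ltn_ord i.
rewrite nth_take; last by lia.
have : (index z (long_arc x) - i.+1 < size (long_arc x))%N.
  by apply: leq_ltn_trans ltj; apply: leq_subr.
set j := index _ _; rewrite /long_arc size_take_min leq_min => /andP[h1 h2].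
rewrite nth_take // nth_traject_default; last by rewrite size_traject in h2.
rewrite pzE iter_pv_nx; last exact: ltnW.
by rewrite -iterSr -subSn // subSS.
Qed.

Local Notation W := (along_wt t_var u_var v_var).
Local Notation O := (over_wt t_var).

Lemma label_factorE p : ~~ under p -> W (kind p.1) p.2 = label_factor p.
Proof.
rewrite /is_under /label_factor; case: (kind p.1) => [o||] /=.
- by rewrite negbK => ->.
- by case: (p.2); rewrite ?expr1z ?exprN1.
- by case: (p.2); rewrite ?expr1z ?exprN1.
Qed.

Lemma over_wt0 p : ~~ under p -> O (kind p.1) p.2 = 0.
Proof. by rewrite /is_under; case: (kind p.1) => //= o; rewrite negbK => ->. Qed.

(** Along the long arc [j] an edge equals its label times the unknown of the initial edge; this
    gives [X], triangular for the distance to the previous underpass. The equation left at an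
    underpass is the opposite of the row of the Alexander matrix, hence the sign. *)
Lemma Delta_fdet n (c : 'I_n -> crossing D) : numbering c ->
  Delta c = (-1) ^+ n * fdet (@code_mx _ W O D).
Proof.
case=> c_inj cP; pose f i := under_branch (c i).
have f_inj : injective f by move=> i j [/c_inj].
have classical_c i : is_classical (kind (c i)) by rewrite -cP codom_f.
have codf z : (z \in codom f) = under z.
  apply/codomP/idP => [[i ->]|uz].
    rewrite /is_under /f /=; have := classical_c i.
    by case: (kind (c i)) => // o _; case: o.
  have : z.1 \in codom c by rewrite cP; move: uz; rewrite /is_under; case: (kind z.1).
  case/codomP=> i zi; exists i; rewrite /f /under_branch -zi.
  move: uz; rewrite /is_under; case: z {zi} => x b /=; case: (kind x) => // o.
  by case: b o => -[].
have notin_codom z : z \notin codom f -> ~~ under z by rewrite codf.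
have dpv z : ~~ under z -> (depth (pv z) < depth z)%N.
  by move=> uz; rewrite [X in (_ < X)%N]kept_depthS //; apply: under_reach.
pose X z j : Rtvu := arc_label z * (root z == f j)%:R.
pose K i j := - alexander_matrix c i j.
rewrite (@fdet_elim _ _ _ _ f X depth K f_inj).
- rewrite big1 => [|z /notin_codom uz]; last first.
    rewrite /code_mx /sysmx eqxx over_wt0 // mul0r subr0.
    have -> : (z == pv z) = false.
      by apply/eqP=> eqz; have := dpv z uz; rewrite -eqz ltnn.
    by rewrite mulr0 subr0.
  rewrite mul1r (@fdet_reindex _ _ K n id) /Delta; last by exists id.
  have -> : alexander_matrix c = -1 *: \matrix_(i, j) K i j.
    by apply/matrixP=> i j; rewrite [RHS]mxE [X in _ * X]mxE /K mulN1r opprK.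
  by rewrite detZ.
- move=> i j; rewrite /X arc_label0 -?codf ?codom_f // mul1r.
  rewrite kept_root_id -?codf ?codom_f ?(inj_eq f_inj) //; exact: under_reach.
- move=> z j /notin_codom uz; rewrite sum_code_mx over_wt0 // mul0r subr0.
  rewrite /X arc_labelS // kept_rootS //; last exact: under_reach.
  by rewrite label_factorE // mulrA subrr.
- move=> i j; rewrite sum_code_mx.
  have XE z : X (pv z) j = if z \in long_arc (c j) then label (c j) z else 0.
    rewrite mem_long_arc // /X -/(f j); case: eqP => [rz|_]; last by rewrite mulr0.
    by rewrite labelE ?mulr1 // mem_long_arc // rz.
  have -> : other_branch (f i) = over_branch (c i).
    rewrite /other_branch /f /=; congr (_, _); have := classical_c i.
    by case: (kind (c i)) => // o _; rewrite negbK.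
  have -> : X (f i) j = (j == i)%:R.
    rewrite /X arc_label0 -?codf ?codom_f // mul1r.
    by rewrite kept_root_id -?codf ?codom_f ?(inj_eq f_inj) 1?eq_sym //; exact: under_reach.
  have [Wu Ou] : W (kind (f i).1) (f i).2 = t_var ^ writhe (c i) /\
      O (kind (f i).1) (f i).2 = 1 - t_var ^ writhe (c i).
    have := classical_c i; rewrite /f /= /writhe.
    by case: (kind (c i)) => // -[] _ /=; rewrite ?expr1z ?exprN1.
  rewrite Wu Ou !XE /K mxE -/(f i).
  by case: (j == i); do 2!case: ifP => _ /=; ring.
- move=> z z' /notin_codom uz _ ne /(code_mx_neq0 ne)[->|]; first exact: dpv.
  by rewrite over_wt0 // eqxx => -[].
Qed.

End LongArcs.

(** * Invariance *)

Lemma tofracX_neq0 (i : 'I_3) : FracField.tofrac ('X_i : {mpoly int[3]}) != 0 :> Rtvu.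
Proof.
rewrite tofrac_eq0; apply/eqP=> /(congr1 (fun p => mcoeff U_(i) p)).
by rewrite mcoeffX eqxx mcoeff0.
Qed.

Lemma t_var_neq0 : t_var != 0. Proof. exact: tofracX_neq0. Qed.
Lemma v_var_neq0 : v_var != 0. Proof. exact: tofracX_neq0. Qed.
Lemma u_var_neq0 : u_var != 0. Proof. exact: tofracX_neq0. Qed.

Section Invariance.
Variables (F : fieldType) (t u v : F).
Hypotheses (t0 : t != 0) (u0 : u != 0) (v0 : v != 0).
Local Notation W := (along_wt t u v).
Local Notation O := (over_wt t).

Definition monomial_unit (x : F) : Prop :=
  exists (e : bool) (a b d : int), x = (-1) ^+ e * t ^ a * v ^ b * u ^ d.

Lemma monomial_unit1 : monomial_unit 1.
Proof. by exists false, 0, 0, 0; rewrite !expr0z expr0 !mulr1. Qed.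

Lemma monomial_unit_sign n : monomial_unit ((-1) ^+ n).
Proof. by exists (odd n), 0, 0, 0; rewrite !expr0z !mulr1 signr_odd. Qed.

Lemma monomial_unitM x y : monomial_unit x -> monomial_unit y -> monomial_unit (x * y).
Proof.
move=> [e [a [b [d ->]]]] [e' [a' [b' [d' ->]]]].
exists (e (+) e'), (a + a'), (b + b'), (d + d'); rewrite signr_addb !expfzDr //.
by rewrite mulrACA; congr (_ * _); rewrite mulrACA; congr (_ * _); rewrite mulrACA.
Qed.

Lemma monomial_unitV x : monomial_unit x -> monomial_unit x^-1.
Proof.
move=> [e [a [b [d ->]]]]; exists e, (- a), (- b), (- d).
by rewrite !invfM invr_sign !invr_expz.
Qed.

Lemma monomial_unit_neq0 x : monomial_unit x -> x != 0.
Proof. by move=> [e [a [b [d ->]]]]; rewrite !mulf_neq0 ?signr_eq0 ?expfz_neq0. Qed.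

Lemma monomial_unit_under_wt o : monomial_unit (under_wt t o).
Proof.
exists false, (if o then -1 else 1), 0, 0.
by case: o; rewrite !expr0z ?exprN1 ?expr1z expr0 !mulr1 mul1r.
Qed.

Lemma fv_move_code_det (K K' : fvdiagram) : fv_move K K' ->
  exists2 x, monomial_unit x & code_det W O K' = x * code_det W O K.
Proof.
case=> [iso|[r1|[r2|[r3|det]]]].
- by exists 1; [apply: monomial_unit1 | rewrite (isotopic_code_det _ _ iso) mul1r].
- have [o [c ->]] := reidemeister1_code_det (along_over_wt t u v) r1.
  exists (W (Classical o) c) => //=; case: ifP => _; first exact: monomial_unit1.
  exact: monomial_unit_under_wt.
- exists 1; first exact: monomial_unit1.
  by rewrite mul1r; apply: reidemeister2_code_det r2.
- exists 1; first exact: monomial_unit1.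
  by rewrite mul1r; apply: reidemeister3_code_det r3.
- exists 1; first exact: monomial_unit1.
  (* Only the two diagrams are gauged by a numbering: the intermediate graph of a detour need not be
     planar, and it is used with gauged weights only. *)
  have [h hP] := alexander_numbering (code_planar K).
  have [h' hP'] := alexander_numbering (code_planar K').
  rewrite mul1r -(gauged_code_det t0 u0 v0 hP) -(gauged_code_det t0 u0 v0 hP').
  by apply/esym/detour_gauged_code_det.
Qed.

Lemma fv_equivalent_code_det (K K' : fvdiagram) : fv_equivalent K K' ->
  exists2 x, monomial_unit x & code_det W O K' = x * code_det W O K.
Proof.
elim=> [D D' /fv_move_code_det //|D|D D' _ [x xu ->]|D D1 D2 _ [x xu ->] _ [y yu ->]].
- by exists 1; [apply: monomial_unit1 | rewrite mul1r].
- by exists x^-1; [apply: monomial_unitV | rewrite mulKf ?monomial_unit_neq0].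
- by exists (y * x); [apply: monomial_unitM | rewrite mulrA].
Qed.

End Invariance.

(** An empty word has no underpass, so the exceptional value 0 of [code_det] does not occur. *)
Lemma Delta_code_det (K : fvcode) n (c : 'I_n -> crossing K) :
  every_comp_has_underpass K -> numbering c -> Delta c = (-1) ^+ n * code_det (along_wt t_var u_var v_var) (over_wt t_var) K.
Proof.
move=> hK hc; rewrite (Delta_fdet hK hc) /code_det.
by case: ifP => // /(allP hK).
Qed.

Theorem theorem4 (K K' : fvdiagram) (n n' : nat)
    (c : 'I_n -> crossing K) (c' : 'I_n' -> crossing K')
    (hc : numbering c) (hc' : numbering c')
    (hK : every_comp_has_underpass K) (hK' : every_comp_has_underpass K')
    (hKK' : fv_equivalent K K') :
  exists (e : bool) (a b d : int),
    Delta c' = (-1) ^+ e * t_var ^ a * v_var ^ b * u_var ^ d * Delta c.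
Proof.
have [x xu eqK] := fv_equivalent_code_det t_var_neq0 u_var_neq0 v_var_neq0 hKK'.
(* The numbers of classical crossings may differ; both signs are absorbed into the unit. *)
have [e [a [b [d eqx]]]] : monomial_unit t_var u_var v_var ((-1) ^+ n' * x * (-1) ^+ n).
  have M := monomial_unitM t_var_neq0 u_var_neq0 v_var_neq0.
  by apply: (M _ _ (M _ _ _ xu)); apply: monomial_unit_sign.
exists e, a, b, d; rewrite -eqx (Delta_code_det hK hc) (Delta_code_det hK' hc') eqK.
by rewrite -[RHS]mulrA signrMK mulrA.
Qed.
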